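(* For every $h\in(1,2)$ there exist a uniformly continuous, weakly divergence-free velocity field $W:[0,1]\times\mathbb{R}^2\to\mathbb{R}^2$ and a compact set $S\subset\mathbb{R}^2$ with $\dim_H S=h$ such that $W$ admits a unique trajectory map $X_W:[0,1]\times\mathbb{R}^2\to\mathbb{R}^2$, and this trajectory map satisfies $\dim_H X_W(t,S)=h$ for all $t\in[0,1)$ and $X_W(1,S)=\{0\}$.
   Context: Trajectory map: Given $U\in C([0,T]\times\mathbb{R}^d;\mathbb{R}^d)$ and $A\subset\mathbb{R}^d$, a map $X_U:[0,T]\times A\to\mathbb{R}^d$ is a trajectory map for $U$ on $A$ if for every $a\in A$ the map $t\mapsto X_U(t,a)$ is differentiable at all $t\in[0,T]$ and $\partial_tX_U(t,a)=U(t,X_U(t,a))$, $X_U(0,a)=a$. When $A$ is not specified, $A=\mathbb{R}^d$. Uniqueness means every such trajectory is uniquely determined by its initial point. $\dim_H$ denotes Hausdorff dimension. *)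

(* Defs.v *)
From Stdlib Require Import Reals Lra List.
Open Scope R_scope.

Definition pt := (R * R)%type.

Definition dist2 (p q : pt) : R :=
  sqrt ((fst p - fst q) ^ 2 + (snd p - snd q) ^ 2).

Definition open2 (O : pt -> Prop) : Prop :=
  forall p, O p -> exists r, r > 0 /\ forall q, dist2 p q < r -> O q.

Definition compact2 (S : pt -> Prop) : Prop :=
  forall (I : Type) (O : I -> pt -> Prop),
    (forall i, open2 (O i)) ->
    (forall p, S p -> exists i, O i p) ->
    exists l : list I, forall p, S p -> exists i, In i l /\ O i p.

Definition image (f : pt -> pt) (A : pt -> Prop) : pt -> Prop :=
  fun y => exists a, A a /\ y = f a.

(* d^s with the convention 0^s = 0 (only used for s > 0) *)
Definition powr (d s : R) : R :=
  if Rle_dec d 0 then 0 else Rpower d s.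

(* H^s(A) = 0, unfolded: for every delta > 0, H^s_delta(A) = 0, i.e. for every
   eps > 0 there is a countable cover by sets U n of diameter <= d n <= delta
   with sum_n (d n)^s <= eps. *)
Definition Hnull (s : R) (A : pt -> Prop) : Prop :=
  forall delta eps, delta > 0 -> eps > 0 ->
    exists (U : nat -> pt -> Prop) (d : nat -> R),
      (forall p, A p -> exists n, U n p) /\
      (forall n, 0 <= d n <= delta) /\
      (forall n p q, U n p -> U n q -> dist2 p q <= d n) /\
      (forall N, sum_f_R0 (fun n => powr (d n) s) N <= eps).

Definition hdim_eq (A : pt -> Prop) (h : R) : Prop :=
  (forall s, s > 0 -> Hnull s A -> h <= s) /\
  (forall b, (forall s, s > 0 -> Hnull s A -> b <= s) -> b <= h).

Definition unif_cont (W : R -> pt -> pt) : Prop :=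
  forall eps, eps > 0 -> exists delta, delta > 0 /\
    forall t s x y, 0 <= t <= 1 -> 0 <= s <= 1 ->
      Rabs (t - s) < delta -> dist2 x y < delta ->
      dist2 (W t x) (W s y) < eps.

Definition continuous2 (f : pt -> R) : Prop :=
  forall p eps, eps > 0 -> exists delta, delta > 0 /\
    forall q, dist2 p q < delta -> Rabs (f q - f p) < eps.

Definition partial1 (f : pt -> R) (p : pt) (l : R) : Prop :=
  derivable_pt_lim (fun x => f (x, snd p)) (fst p) l.
Definition partial2 (f : pt -> R) (p : pt) (l : R) : Prop :=
  derivable_pt_lim (fun y => f (fst p, y)) (snd p) l.

Fixpoint Ck (n : nat) (f : pt -> R) : Prop :=
  match n with
  | O => continuous2 f
  | S m => continuous2 f /\ exists f1 f2 : pt -> R,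
             (forall p, partial1 f p (f1 p)) /\ (forall p, partial2 f p (f2 p)) /\
             Ck m f1 /\ Ck m f2
  end.

Definition smooth2 (f : pt -> R) : Prop := forall n, Ck n f.

Definition supp_in_box (phi : pt -> R) (Rb : R) : Prop :=
  forall p, (Rabs (fst p) > Rb \/ Rabs (snd p) > Rb) -> phi p = 0.

Definition test_fun (phi : pt -> R) : Prop :=
  smooth2 phi /\ exists Rb, Rb > 0 /\ supp_in_box phi Rb.

(* Integral over R^2 of a function supported in [-Rb,Rb]^2, as an iterated
   Riemann integral, equals v. *)
Definition box_integral_is (F : pt -> R) (Rb v : R) : Prop :=
  exists (pr_in : forall x, Riemann_integrable (fun y => F (x, y)) (- Rb) Rb)
         (pr_out : Riemann_integrable (fun x => RiemannInt (pr_in x)) (- Rb) Rb),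
    RiemannInt pr_out = v.

Definition weakly_div_free (W : R -> pt -> pt) : Prop :=
  forall t, 0 <= t <= 1 ->
  forall phi g1 g2 : pt -> R, test_fun phi ->
    (forall p, partial1 phi p (g1 p)) -> (forall p, partial2 phi p (g2 p)) ->
    forall Rb, Rb > 0 -> supp_in_box phi Rb ->
      box_integral_is
        (fun p => fst (W t p) * g1 p + snd (W t p) * g2 p) Rb 0.

Definition solves_ode (U : R -> pt -> pt) (gamma : R -> pt) : Prop :=
  forall t, 0 <= t <= 1 ->
  forall eps, eps > 0 -> exists delta, delta > 0 /\
    forall k, k <> 0 -> 0 <= t + k <= 1 -> Rabs k < delta ->
      Rabs ((fst (gamma (t + k)) - fst (gamma t)) / k - fst (U t (gamma t))) < eps /\
      Rabs ((snd (gamma (t + k)) - snd (gamma t)) / k - snd (U t (gamma t))) < eps.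

(* X is a trajectory map for U on R^2 (only t in [0,1] matters) *)
Definition trajectory_map (U : R -> pt -> pt) (X : R -> pt -> pt) : Prop :=
  forall a, solves_ode U (fun t => X t a) /\ X 0 a = a.

Definition unique_trajectories (U : R -> pt -> pt) : Prop :=
  forall g1 g2 : R -> pt, solves_ode U g1 -> solves_ode U g2 -> g1 0 = g2 0 ->
    forall t, 0 <= t <= 1 -> g1 t = g2 t.

(* Main.v *)
(* The set is S = C x C, where C consists of the sums of b_l 2^-(l+1) over a set A of digit slots of
   density h/2 (a Beatty sequence). A cover by sets of small h-th power sum would yield, since the
   complement of A has bounded gaps, a cover of Cantor space by cylinders of total measure at most
   1/2.

   The flow is an infinite succession of horizontal and vertical shears with bounded Lipschitz
   profiles. A digit of a point of C is a Lipschitz function of the point, because A misses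
   infinitely many slots; hence three shears can move the digits in slot k, of both coordinates
   simultaneously, to a slot j > k that is still free:
     y += 2^-(j+1) x_k,   x += 2^-(j+1) y_k - 2^-(k+1) y_j,   y -= 2^-(k+1) x_j.
   After slots 0, ..., k-1 have been emptied, the image of S lies within 2^-k of the origin. The
   displacements decay geometrically, so the shears can be performed during time intervals of
   geometrically decaying length while the velocities still tend to 0 as t tends to 1, which makes
   the field uniformly continuous. Before time 1 the flow is bi-Lipschitz and preserves the
   dimension. *)
From Stdlib Require Import Reals ZArith Lra Lia List Bool ClassicalEpsilon IndefiniteDescription.
From Coquelicot Require Import Coquelicot.
Require Import Defs.
Open Scope R_scope.

(** Before time 1 the flow is invertible, so a digit cannot just be deleted; it has to be carried to
    a finer slot, and room for it must remain. The density h/2 < 1 leaves infinitely many slots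
    free. A shear changes one coordinate by a function of the other. A digit can therefore be
    cancelled only by reading a copy of it in the other coordinate, which is why one move takes
    three shears and exchanges the coordinates: x_k ends in slot j of y, and y_k in slot j of x. The
    shears of block k have size at most 2^-k. Since 1/2 < (4/5)^3, shear n has amplitude at most 2
    (4/5)^n; lasting (9/10)^n / 10, it has speed at most 40 (8/9)^n, which is summable. No bound on
    the Lipschitz constants of the profiles uniform in n is available, because they depend on how
    far away the next free slot is. Uniqueness is therefore proved one shear at a time by exact
    integration, and reaches time 1 by continuity. *)

(** * Powers of one half and geometric series *)

Lemma half_pow_pos (n : nat) : 0 < (/ 2) ^ n.
Proof. apply pow_lt; lra. Qed.

Lemma half_pow_le (m n : nat) : (m <= n)%nat -> (/ 2) ^ n <= (/ 2) ^ m.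
Proof.
  induction 1 as [|n _ IH]; [lra|].
  simpl. pose proof (half_pow_pos n). lra.
Qed.

Lemma Series_zero : Series (fun _ : nat => 0) = 0.
Proof.
  rewrite (Series_ext _ (fun n => 0 * (fun _ : nat => 0) n)) by (intros; ring).
  rewrite Series_scal_l. ring.
Qed.

Lemma Series_nonneg (a : nat -> R) : (forall n, 0 <= a n) -> ex_series a -> 0 <= Series a.
Proof.
  intros Ha He. rewrite <- Series_zero. apply Series_le; [|exact He].
  intros n. specialize (Ha n). lra.
Qed.

Lemma is_series_geom_half : is_series (fun n => (/ 2) ^ S n) 1.
Proof.
  assert (Hq : Rabs (/ 2) < 1) by (rewrite Rabs_pos_eq; lra).
  pose proof (is_series_scal_l (/ 2) _ _ (is_series_geom (/ 2) Hq)) as H.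
  replace 1 with (/ 2 * / (1 - / 2)) by field. exact H.
Qed.

(** * Binary expansions *)

Definition val (b : nat -> bool) : R :=
  Series (fun l => if b l then (/ 2) ^ S l else 0).

Lemma ex_val (b : nat -> bool) : ex_series (fun l => if b l then (/ 2) ^ S l else 0).
Proof.
  apply (ex_series_le (V := R_CompleteNormedModule) _ (fun n => (/ 2) ^ S n)).
  - intros n. pose proof (half_pow_pos (S n)).
    change (Rabs (if b n then (/ 2) ^ S n else 0) <= (/ 2) ^ S n).
    destruct (b n); [rewrite Rabs_pos_eq|rewrite Rabs_R0]; lra.
  - exists 1. apply is_series_geom_half.
Qed.

(** Self-similarity of binary expansions: the recursion behind the inductions on slots below. *)
Lemma val_step (b : nat -> bool) :
  val b = (if b O then / 2 else 0) + / 2 * val (fun l => b (S l)).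
Proof.
  unfold val. rewrite Series_incr_1 by apply ex_val.
  rewrite <- Series_scal_l. f_equal.
  - destruct (b O); simpl; lra.
  - apply Series_ext. intros n. destruct (b (S n)); simpl; ring.
Qed.

Lemma val_bounds (b : nat -> bool) : 0 <= val b <= 1.
Proof.
  split.
  - apply Series_nonneg; [|apply ex_val].
    intros n. pose proof (half_pow_pos (S n)). destruct (b n); lra.
  - rewrite <- (is_series_unique _ _ is_series_geom_half).
    apply Series_le; [|exists 1; apply is_series_geom_half].
    intros n. pose proof (half_pow_pos (S n)). destruct (b n); lra.
Qed.

Lemma val_zero : val (fun _ => false) = 0.
Proof. apply Series_zero. Qed.

(** Even if all other digits are 1, the missing digit costs its own weight. This keeps expansions
    with an empty slot away from the ambiguity 0.0111... = 0.1000.... *)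
Lemma val_gap (m : nat) : forall b, b m = false -> val b <= 1 - (/ 2) ^ S m.
Proof.
  induction m as [|m IH]; intros b Hb; rewrite val_step.
  - rewrite Hb. pose proof (val_bounds (fun l => b (S l))). simpl. lra.
  - specialize (IH (fun l => b (S l)) Hb).
    change ((/ 2) ^ S (S m)) with (/ 2 * (/ 2) ^ S m). destruct (b O); lra.
Qed.

(* Two expansions that differ before a slot [m] left empty by both cannot be adjacent. *)
Lemma val_sep (i : nat) : forall m b c, (i < m)%nat -> b m = false -> c m = false ->
  b i <> c i -> (/ 2) ^ S m <= Rabs (val b - val c).
Proof.
  assert (Hhead : forall m b c, b (S m) = false -> c (S m) = false -> b O <> c O ->
    (/ 2) ^ S (S m) <= Rabs (val b - val c)).
  { intros m b c Hb Hc Hd. rewrite (val_step b), (val_step c).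
    pose proof (val_gap m (fun l => b (S l)) Hb). pose proof (val_gap m (fun l => c (S l)) Hc).
    pose proof (val_bounds (fun l => b (S l))). pose proof (val_bounds (fun l => c (S l))).
    change ((/ 2) ^ S (S m)) with (/ 2 * (/ 2) ^ S m).
    destruct (b O), (c O); try congruence; unfold Rabs; destruct Rcase_abs; lra. }
  induction i as [|i IH]; intros m b c Hm Hb Hc Hd; (destruct m as [|m]; [lia|]).
  - apply Hhead; assumption.
  - destruct (Bool.bool_dec (b O) (c O)) as [He|He]; [|apply Hhead; assumption].
    specialize (IH m (fun l => b (S l)) (fun l => c (S l)) ltac:(lia) Hb Hc Hd).
    rewrite (val_step b), (val_step c), He.
    replace (_ - _) with (/ 2 * (val (fun l => b (S l)) - val (fun l => c (S l)))) by ring.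
    rewrite Rabs_mult, (Rabs_pos_eq (/ 2)) by lra.
    change ((/ 2) ^ S (S m)) with (/ 2 * (/ 2) ^ S m). lra.
Qed.

Lemma val_agree (n : nat) : forall b c, (forall l, (l < n)%nat -> b l = c l) ->
  Rabs (val b - val c) <= (/ 2) ^ n.
Proof.
  induction n as [|n IH]; intros b c H.
  - pose proof (val_bounds b). pose proof (val_bounds c). apply Rabs_le. simpl. lra.
  - rewrite (val_step b), (val_step c), (H O) by lia.
    replace (_ - _) with (/ 2 * (val (fun l => b (S l)) - val (fun l => c (S l)))) by ring.
    rewrite Rabs_mult, (Rabs_pos_eq (/ 2)) by lra.
    assert (Hn : Rabs (val (fun l => b (S l)) - val (fun l => c (S l))) <= (/ 2) ^ n)
      by (apply IH; intros l Hl; apply H; lia).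
    simpl. lra.
Qed.

Lemma val_ext (b c : nat -> bool) : (forall l, b l = c l) -> val b = val c.
Proof. intros H. apply Series_ext. intros n. rewrite H. reflexivity. Qed.

Definition upd (b : nat -> bool) (i : nat) (v : bool) : nat -> bool :=
  fun l => if Nat.eqb l i then v else b l.

Lemma upd_eq b i v : upd b i v i = v.
Proof. unfold upd. rewrite Nat.eqb_refl. reflexivity. Qed.

Lemma upd_neq b i v l : l <> i -> upd b i v l = b l.
Proof. intros H. unfold upd. apply Nat.eqb_neq in H. rewrite H. reflexivity. Qed.

(** Digits are compared with the sequence whose slot is cleared, so the old digit never enters. *)
Lemma val_upd (i : nat) : forall b v,
  val (upd b i v) = val (upd b i false) + (if v then (/ 2) ^ S i else 0).
Proof.
  induction i as [|i IH]; intros b v;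
    rewrite (val_step (upd b _ v)), (val_step (upd b _ false)).
  - unfold upd; simpl. destruct v; lra.
  - change (fun l => upd b (S i) v (S l)) with (upd (fun l => b (S l)) i v).
    change (fun l => upd b (S i) false (S l)) with (upd (fun l => b (S l)) i false).
    rewrite (IH _ v). unfold upd; simpl. destruct v; lra.
Qed.

(** * Cantor space *)

(* [prefix z n] lists the first [n] digits of [z], the latest one first. *)
Fixpoint prefix (z : nat -> bool) (n : nat) : list bool :=
  match n with O => nil | S m => z m :: prefix z m end.

Lemma prefix_length z n : length (prefix z n) = n.
Proof. induction n; simpl; congruence. Qed.

Lemma prefix_eq z z' n : prefix z n = prefix z' n <-> forall i, (i < n)%nat -> z i = z' i.
Proof.
  split.
  - induction n as [|n IH]; simpl; intros H i Hi; [lia|].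
    injection H as H1 H2. destruct (Nat.eq_dec i n) as [->|]; [exact H1|].
    apply IH; [exact H2|lia].
  - induction n as [|n IH]; simpl; intros H; [reflexivity|].
    rewrite H by lia. f_equal. apply IH. intros; apply H; lia.
Qed.

(** The branch is built by always taking the child [true] if it is bad. This one principle yields
    both the compactness of the set and the point missed by a cover of small measure. *)
Lemma cantor_path (Bad : list bool -> Prop) :
  Bad nil -> (forall w, Bad w -> Bad (true :: w) \/ Bad (false :: w)) ->
  exists z, forall n, Bad (prefix z n).
Proof.
  intros H0 Hs.
  set (nx := fun w => if excluded_middle_informative (Bad (true :: w)) then true else false).
  set (w := fix w n := match n with O => nil | S m => nx (w m) :: w m end).
  exists (fun n => nx (w n)). intros n.
  assert (Hp : prefix (fun n => nx (w n)) n = w n)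
    by (induction n as [|n IH]; simpl; [reflexivity|rewrite IH; reflexivity]).
  rewrite Hp. clear Hp. induction n as [|n IH]; simpl; [exact H0|].
  unfold nx. destruct excluded_middle_informative as [Ht|Hf]; [exact Ht|].
  destruct (Hs _ IH); tauto.
Qed.

Lemma sum_le_mono (a : nat -> R) (m n : nat) : (forall k, 0 <= a k) -> (m <= n)%nat ->
  sum_f_R0 a m <= sum_f_R0 a n.
Proof.
  intros Ha. induction 1 as [|n _ IH]; [lra|]. simpl. specialize (Ha (S n)). lra.
Qed.

Lemma sum_ge_term (a : nat -> R) (n : nat) : (forall k, 0 <= a k) -> a n <= sum_f_R0 a n.
Proof.
  intros Ha. destruct n as [|n]; simpl; [lra|].
  assert (0 <= sum_f_R0 a n) by (apply cond_pos_sum; exact Ha). lra.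
Qed.

(* A greedy choice of digits keeps the measure of the part of the current cylinder that is
   covered below half of the measure of the cylinder. *)
Lemma cantor_uncovered (zk : nat -> nat -> bool) (lk : nat -> nat) :
  (forall N, sum_f_R0 (fun k => (/ 2) ^ lk k) N <= / 2) ->
  exists z, forall k, prefix z (lk k) <> prefix (zk k) (lk k).
Proof.
  intros Hsum.
  set (meet := fun k w => exists z, prefix z (length w) = w /\
                                    prefix z (lk k) = prefix (zk k) (lk k)).
  (* Two cylinders are nested or disjoint, so [nu k w] is the measure of the intersection of
     cylinder [w] with the covering cylinder [k]. *)
  set (nu := fun k w => if excluded_middle_informative (meet k w)
                        then Rmin ((/ 2) ^ length w) ((/ 2) ^ lk k) else 0).
  assert (Hmeet : forall k x w, meet k (x :: w) -> meet k w).
  { intros k x w (z & H1 & H2). exists z. split; [|exact H2].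
    simpl in H1. injection H1 as _ H1. exact H1. }
  assert (Hnu0 : forall k w, 0 <= nu k w).
  { intros k w. unfold nu. destruct excluded_middle_informative; [|lra].
    apply Rmin_glb; left; apply half_pow_pos. }
  assert (Hnu : forall k w, nu k (true :: w) + nu k (false :: w) <= nu k w).
  { intros k w. destruct (classic (meet k w)) as [Hm|Hm].
    2:{ unfold nu. destruct (excluded_middle_informative (meet k (true :: w))) as [H1|H1];
        [apply Hmeet in H1; tauto|].
        destruct (excluded_middle_informative (meet k (false :: w))) as [H2|H2];
        [apply Hmeet in H2; tauto|].
        destruct excluded_middle_informative; [tauto|lra]. }
    (* Either the covering cylinder contains [w], and each child gets half the measure of [w], or it
       lies strictly inside [w] and meets only one child. *)
    destruct (le_lt_dec (lk k) (length w)) as [Hl|Hl].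
    - assert (Hc : forall x, nu k (x :: w) <= / 2 * (/ 2) ^ length w).
      { intros x. unfold nu. destruct excluded_middle_informative.
        - apply Rmin_l.
        - pose proof (half_pow_pos (length w)). lra. }
      assert (Hw : nu k w = (/ 2) ^ length w).
      { unfold nu. destruct excluded_middle_informative; [|tauto].
        apply Rmin_left, half_pow_le, Hl. }
      pose proof (Hc true). pose proof (Hc false). lra.
    - assert (Hc : forall x, nu k (x :: w) <= (/ 2) ^ lk k).
      { intros x. unfold nu. destruct excluded_middle_informative.
        - apply Rmin_r.
        - left; apply half_pow_pos. }
      assert (Hw : nu k w = (/ 2) ^ lk k).
      { unfold nu. destruct excluded_middle_informative; [|tauto].
        apply Rmin_right, half_pow_le. lia. }
      assert (Hx : forall x, meet k (x :: w) -> zk k (length w) = x).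
      { intros x (z & H1 & H2). simpl in H1. injection H1 as H1 _.
        rewrite <- H1. symmetry. apply (proj1 (prefix_eq _ _ _) H2). exact Hl. }
      pose proof (Hc true). pose proof (Hc false).
      destruct (excluded_middle_informative (meet k (true :: w))) as [H1|H1].
      + destruct (excluded_middle_informative (meet k (false :: w))) as [H2|H2].
        * apply Hx in H1. apply Hx in H2. congruence.
        * assert (nu k (false :: w) = 0)
            by (unfold nu; destruct excluded_middle_informative; [tauto|reflexivity]).
          lra.
      + assert (nu k (true :: w) = 0)
          by (unfold nu; destruct excluded_middle_informative; [tauto|reflexivity]).
        lra. }
  set (Bad := fun w => forall N, sum_f_R0 (fun k => nu k w) N <= / 2 * (/ 2) ^ length w).
  destruct (cantor_path Bad) as (z & Hz).
  - intros N. simpl. rewrite Rmult_1_r. eapply Rle_trans; [|apply (Hsum N)].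
    apply sum_Rle. intros k _. unfold nu. destruct excluded_middle_informative.
    + apply Rmin_r.
    + left; apply half_pow_pos.
  (* If both children were covered by more than half, adding the two sums up to the larger index
     would show the same for the parent. *)
  - intros w Hw. apply NNPP. intros Hno. apply not_or_and in Hno. destruct Hno as [H1 H2].
    apply not_all_ex_not in H1. destruct H1 as [N1 H1].
    apply not_all_ex_not in H2. destruct H2 as [N2 H2].
    specialize (Hw (Nat.max N1 N2)). apply Rnot_le_lt in H1. apply Rnot_le_lt in H2.
    pose proof (sum_le_mono (fun k => nu k (true :: w)) N1 (Nat.max N1 N2)
                  (fun k => Hnu0 k _) ltac:(lia)).
    pose proof (sum_le_mono (fun k => nu k (false :: w)) N2 (Nat.max N1 N2)
                  (fun k => Hnu0 k _) ltac:(lia)).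
    pose proof (sum_Rle (fun k => nu k (true :: w) + nu k (false :: w)) (fun k => nu k w)
                  (Nat.max N1 N2) (fun k _ => Hnu k w)) as Hle.
    rewrite plus_sum in Hle. simpl in H1, H2. lra.
  (* If the branch entered cylinder [k], this single term would already be the full measure of the
     prefix, not half of it. *)
  - exists z. intros k Heq. specialize (Hz (lk k) k).
    pose proof (sum_ge_term (fun k' => nu k' (prefix z (lk k))) k (fun k' => Hnu0 k' _)) as Ht.
    cbv beta in Ht.
    assert (Hv : nu k (prefix z (lk k)) = (/ 2) ^ lk k).
    { unfold nu. rewrite prefix_length. destruct excluded_middle_informative as [_|Hn].
      - apply Rmin_left; lra.
      - exfalso. apply Hn. exists z. rewrite prefix_length. split; [reflexivity|exact Heq]. }
    rewrite prefix_length in Hz. pose proof (half_pow_pos (lk k)). lra.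
Qed.
(** * The Cantor set and its dimension *)

Lemma dist2_fst p q : Rabs (fst p - fst q) <= dist2 p q.
Proof.
  unfold dist2. rewrite <- sqrt_Rsqr_abs. apply sqrt_le_1_alt.
  rewrite Rsqr_pow2. pose proof (pow2_ge_0 (snd p - snd q)). lra.
Qed.

Lemma dist2_snd p q : Rabs (snd p - snd q) <= dist2 p q.
Proof.
  unfold dist2. rewrite <- sqrt_Rsqr_abs. apply sqrt_le_1_alt.
  rewrite Rsqr_pow2. pose proof (pow2_ge_0 (fst p - fst q)). lra.
Qed.

Lemma dist2_le_sum p q : dist2 p q <= Rabs (fst p - fst q) + Rabs (snd p - snd q).
Proof.
  unfold dist2. set (x := fst p - fst q). set (y := snd p - snd q).
  pose proof (Rabs_pos x). pose proof (Rabs_pos y).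
  rewrite <- (sqrt_Rsqr (Rabs x + Rabs y)) by lra.
  apply sqrt_le_1_alt. unfold Rsqr. rewrite <- (pow2_abs x), <- (pow2_abs y). nra.
Qed.

Lemma dist2_pos p q : 0 <= dist2 p q.
Proof. apply sqrt_pos. Qed.

(* [a n] counts the digit slots below [n] that are in use. *)
Definition rank_function (a : nat -> nat) : Prop :=
  a O = O /\ forall n, a (S n) = a n \/ a (S n) = S (a n).

Definition slot (a : nat -> nat) (l : nat) : bool := negb (Nat.eqb (a (S l)) (a l)).

(** One sequence feeds both coordinates: its even digits fill the used slots of x, its odd digits
    those of y. Hence the first [2 * a n] digits fix both coordinates up to 2^-n. *)
Definition xdig (a : nat -> nat) (z : nat -> bool) (l : nat) : bool :=
  slot a l && z (2 * a l)%nat.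
Definition ydig (a : nat -> nat) (z : nat -> bool) (l : nat) : bool :=
  slot a l && z (2 * a l + 1)%nat.

Definition cpt (a : nat -> nat) (z : nat -> bool) : pt := (val (xdig a z), val (ydig a z)).
Definition cset (a : nat -> nat) : pt -> Prop := fun p => exists z, p = cpt a z.

Lemma slot_false a l : slot a l = false <-> a (S l) = a l.
Proof.
  unfold slot. rewrite negb_false_iff. apply Nat.eqb_eq.
Qed.

Lemma rank_mono a m n : rank_function a -> (m <= n)%nat -> (a m <= a n)%nat.
Proof.
  intros [_ Ha]. induction 1 as [|n _ IH]; [lia|]. destruct (Ha n); lia.
Qed.

Lemma slot_rank_lt a l n : rank_function a -> slot a l = true -> (l < n)%nat -> (a l < a n)%nat.
Proof.
  intros Ha Hl Hn. pose proof (rank_mono a (S l) n Ha ltac:(lia)).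
  assert (a (S l) <> a l) by (intros E; apply slot_false in E; congruence).
  destruct Ha as [_ Ha]. destruct (Ha l); lia.
Qed.

Lemma rank_surj a n j : rank_function a -> (j < a n)%nat ->
  exists l, (l < n)%nat /\ slot a l = true /\ a l = j.
Proof.
  intros [H0 Ha]. induction n as [|n IH]; intros Hj; [lia|].
  destruct (lt_dec j (a n)) as [Hl|Hl].
  - destruct (IH Hl) as (l & ? & ? & ?). exists l. repeat split; try assumption; lia.
  - exists n. destruct (Ha n) as [E|E]; [lia|].
    repeat split; try lia. unfold slot. rewrite E, negb_true_iff. apply Nat.eqb_neq. lia.
Qed.

Lemma cpt_close a z z' n : rank_function a ->
  prefix z (2 * a n) = prefix z' (2 * a n) -> dist2 (cpt a z) (cpt a z') <= 2 * (/ 2) ^ n.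
Proof.
  intros Ha Hp. pose proof (proj1 (prefix_eq _ _ _) Hp) as He.
  eapply Rle_trans; [apply dist2_le_sum|]. simpl fst; simpl snd.
  assert (Rabs (val (xdig a z) - val (xdig a z')) <= (/ 2) ^ n).
  { apply val_agree. intros l Hl. unfold xdig. destruct (slot a l) eqn:E; [|reflexivity].
    pose proof (slot_rank_lt a l n Ha E Hl). simpl. apply He. lia. }
  assert (Rabs (val (ydig a z) - val (ydig a z')) <= (/ 2) ^ n).
  { apply val_agree. intros l Hl. unfold ydig. destruct (slot a l) eqn:E; [|reflexivity].
    pose proof (slot_rank_lt a l n Ha E Hl). simpl andb. apply He. lia. }
  lra.
Qed.

(** Converse of [cpt_close]. A differing digit lies in a slot below [n], hence before the slot [m]
    that all these expansions leave empty, and [val_sep] applies. *)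
Lemma cpt_separated a z z' n m : rank_function a -> (n <= m)%nat -> slot a m = false ->
  dist2 (cpt a z) (cpt a z') < (/ 2) ^ S m -> prefix z (2 * a n) = prefix z' (2 * a n).
Proof.
  intros Ha Hn Hm Hd. apply prefix_eq. intros i Hi.
  pose proof (dist2_fst (cpt a z) (cpt a z')) as Hx.
  pose proof (dist2_snd (cpt a z) (cpt a z')) as Hy. simpl fst in Hx. simpl snd in Hy.
  pose proof (Nat.div_mod_eq i 2) as Ei. pose proof (Nat.mod_upper_bound i 2 ltac:(lia)) as Hb.
  destruct (rank_surj a n (i / 2) Ha ltac:(lia)) as (l & Hl & Hs & Hr).
  apply NNPP. intros Hne.
  destruct (Nat.eq_dec (i mod 2) 0) as [E|E].
  - assert (xdig a z l <> xdig a z' l).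
    { unfold xdig. rewrite Hs, Hr, !andb_true_l.
      replace (2 * (i / 2))%nat with i by lia. exact Hne. }
    assert ((/ 2) ^ S m <= Rabs (val (xdig a z) - val (xdig a z'))).
    { apply (val_sep l); try assumption; try lia; unfold xdig; rewrite Hm; reflexivity. }
    lra.
  - assert (ydig a z l <> ydig a z' l).
    { unfold ydig. rewrite Hs, Hr, !andb_true_l.
      replace (2 * (i / 2) + 1)%nat with i by lia. exact Hne. }
    assert ((/ 2) ^ S m <= Rabs (val (ydig a z) - val (ydig a z'))).
    { apply (val_sep l); try assumption; try lia; unfold ydig; rewrite Hm; reflexivity. }
    lra.
Qed.

Lemma half_pow_small (eps : R) : 0 < eps -> exists n, (/ 2) ^ n < eps.
Proof.
  intros He. destruct (pow_lt_1_zero (/ 2) ltac:(rewrite Rabs_pos_eq; lra) eps He) as [N HN].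
  exists N. specialize (HN N (le_n N)). rewrite Rabs_pos_eq in HN; [exact HN|].
  left; apply half_pow_pos.
Qed.

(** If no finite subfamily sufficed, some branch would consist of cylinders without finite subcover;
    but a single open set contains the images of all long cylinders around the point at its end. *)
Lemma cset_compact a : rank_function a -> compact2 (cset a).
Proof.
  intros Ha I O Ho Hc.
  set (Good := fun w => exists l : list I, forall z, prefix z (length w) = w ->
                          exists i, In i l /\ O i (cpt a z)).
  destruct (classic (Good nil)) as [[l Hl]|Hbad].
  { exists l. intros p [z ->]. apply (Hl z). reflexivity. }
  exfalso. destruct (cantor_path (fun w => ~ Good w) Hbad) as [z Hz].
  - intros w Hw. apply NNPP. intros Hno. apply not_or_and in Hno. destruct Hno as [H1 H2].
    apply NNPP in H1. apply NNPP in H2. destruct H1 as [l1 H1]. destruct H2 as [l2 H2].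
    apply Hw. exists (l1 ++ l2). intros z Hz.
    destruct (z (length w)) eqn:E.
    + destruct (H1 z) as (i & Hi & HO); [simpl; congruence|].
      exists i. split; [apply in_or_app; left|]; assumption.
    + destruct (H2 z) as (i & Hi & HO); [simpl; congruence|].
      exists i. split; [apply in_or_app; right|]; assumption.
  - destruct (Hc (cpt a z)) as [i Hi]; [exists z; reflexivity|].
    destruct (Ho i _ Hi) as (r & Hr & Hb).
    destruct (half_pow_small (r / 2)) as [n Hn]; [lra|].
    apply (Hz (2 * a n)%nat). exists (i :: nil). intros z' Hz'.
    rewrite prefix_length in Hz'. exists i. split; [left; reflexivity|].
    apply Hb. pose proof (cpt_close a z z' n Ha (eq_sym Hz')). lra.
Qed.

(** The word read as a binary number: it numbers the cylinders of a given length, as the covers in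
    [Hnull] are indexed by natural numbers. *)
Fixpoint code (w : list bool) : nat :=
  match w with nil => O | b :: w' => ((if b then 1 else 0) + 2 * code w')%nat end.

Lemma code_lt w : (code w < 2 ^ length w)%nat.
Proof. induction w as [|b w IH]; simpl; [lia|]. destruct b; lia. Qed.

Lemma code_inj w : forall w', length w = length w' -> code w = code w' -> w = w'.
Proof.
  induction w as [|b w IH]; intros [|b' w'] Hl Hc; simpl in *; try lia; [reflexivity|].
  destruct b, b'; try lia; f_equal; apply IH; lia.
Qed.

Lemma sum_finite_const (M N : nat) (c : R) : 0 <= c ->
  sum_f_R0 (fun k => if lt_dec k M then c else 0) N <= INR M * c.
Proof.
  intros Hc.
  assert (H : sum_f_R0 (fun k => if lt_dec k M then c else 0) N = INR (Nat.min (S N) M) * c).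
  { induction N as [|N IH].
    - simpl sum_f_R0. destruct (lt_dec 0 M).
      + replace (Nat.min 1 M) with 1%nat by lia. simpl; ring.
      + replace (Nat.min 1 M) with 0%nat by lia. simpl; ring.
    - rewrite tech5, IH. destruct (lt_dec (S N) M).
      + replace (Nat.min (S (S N)) M) with (S (Nat.min (S N) M)) by lia. rewrite S_INR. ring.
      + replace (Nat.min (S (S N)) M) with (Nat.min (S N) M) by lia. ring. }
  rewrite H. apply Rmult_le_compat_r; [exact Hc|]. apply le_INR. lia.
Qed.

Lemma two_powers_small (c e eps : R) : 0 < e -> 0 < eps ->
  exists N, forall n, (N <= n)%nat -> Rpower 2 (c - e * INR n) <= eps.
Proof.
  intros He Heps. destruct (INR_unbounded ((c - ln eps / ln 2) / e)) as [N HN].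
  exists N. intros n Hn. apply le_INR in Hn.
  assert (Hln : 0 < ln 2) by (rewrite <- ln_1; apply ln_increasing; lra).
  assert (H : c - e * INR n <= ln eps / ln 2).
  { apply Rlt_le in HN. apply (Rmult_le_compat_l e) in HN; [|lra].
    apply (Rmult_le_compat_l e) in Hn; [|lra].
    replace (e * ((c - ln eps / ln 2) / e)) with (c - ln eps / ln 2) in HN by (field; lra). lra. }
  rewrite <- (exp_ln eps Heps). unfold Rpower.
  destruct (Rle_lt_or_eq_dec ((c - e * INR n) * ln 2) (ln eps)) as [Hl|Hl].
  - apply (Rmult_le_compat_r (ln 2)) in H; [|lra].
    unfold Rdiv in H. rewrite Rmult_assoc, Rinv_l, Rmult_1_r in H; lra.
  - left. apply exp_increasing, Hl.
  - rewrite Hl. lra.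
Qed.

Lemma half_pow_Rpower n : (/ 2) ^ n = Rpower 2 (- INR n).
Proof. rewrite Rpower_Ropp, Rpower_pow by lra. apply pow_inv. Qed.

Lemma powr_pos_eq d s : 0 < d -> powr d s = Rpower d s.
Proof. intros H. unfold powr. destruct Rle_dec; [lra|reflexivity]. Qed.

Lemma powr_0 s : powr 0 s = 0.
Proof. unfold powr. destruct Rle_dec; [reflexivity|lra]. Qed.

Lemma powr_nonneg d s : 0 <= powr d s.
Proof. unfold powr. destruct Rle_dec; [lra|]. left; apply exp_pos. Qed.

Definition rank_density (a : nat -> nat) (theta : R) : Prop :=
  forall n, theta * INR n - 1 < INR (a n) <= theta * INR n.

(** The 2^(2 a n) cylinders of length [2 * a n] have diameter at most 2^(1-n), so their power sum is
    at most 2^(s - (s - 2 theta) n), which tends to 0. *)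
Lemma cset_null a theta s : rank_function a -> rank_density a theta -> 0 < s -> 2 * theta < s ->
  Hnull s (cset a).
Proof.
  intros Ha Hd Hs Hst delta eps Hdelta Heps.
  destruct (two_powers_small s (s - 2 * theta) eps) as [N1 HN1]; [lra|lra|].
  destruct (two_powers_small 1 1 delta) as [N2 HN2]; [lra|lra|].
  set (n := Nat.max N1 N2). specialize (HN1 n ltac:(lia)). specialize (HN2 n ltac:(lia)).
  set (D := 2 * (/ 2) ^ n).
  assert (HD : D = Rpower 2 (1 - INR n)).
  { unfold D. rewrite half_pow_Rpower. unfold Rminus. rewrite Rpower_plus, Rpower_1; lra. }
  assert (HDp : 0 < D) by (rewrite HD; apply exp_pos).
  set (M := (2 ^ (2 * a n))%nat).
  exists (fun k p => (k < M)%nat /\ exists z, p = cpt a z /\ code (prefix z (2 * a n)) = k).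
  (* Beyond index [M] the covering sets are empty; diameter 0 makes them contribute nothing. *)
  exists (fun k => if lt_dec k M then D else 0). repeat split.
  - intros p [z ->]. exists (code (prefix z (2 * a n))). split; [|exists z; tauto].
    pose proof (code_lt (prefix z (2 * a n))) as H. rewrite prefix_length in H. exact H.
  - destruct lt_dec; lra.
  - rewrite Rmult_1_l in HN2. destruct lt_dec; lra.
  - intros k p q [Hk (z & -> & Hz)] [_ (z' & -> & Hz')].
    destruct lt_dec; [|lia]. apply cpt_close; [exact Ha|].
    apply code_inj; [rewrite !prefix_length; reflexivity|congruence].
  - intros N. rewrite (sum_eq _ (fun k => if lt_dec k M then powr D s else 0)).
    2:{ intros k _. destruct lt_dec; [reflexivity|apply powr_0]. }
    eapply Rle_trans; [apply sum_finite_const, powr_nonneg|].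
    rewrite powr_pos_eq by exact HDp. rewrite HD, Rpower_mult.
    unfold M. rewrite pow_INR. replace (INR 2) with 2 by (simpl; ring).
    rewrite <- Rpower_pow by lra. rewrite <- Rpower_plus.
    eapply Rle_trans; [|exact HN1]. apply Rle_Rpower; [lra|].
    rewrite mult_INR. replace (INR 2) with 2 by (simpl; ring).
    destruct (Hd n) as [_ H]. nra.
Qed.

Definition bounded_gaps (a : nat -> nat) (K : nat) : Prop :=
  forall n, exists m, (n <= m < n + K)%nat /\ slot a m = false.

Lemma dyadic_scale (x : R) (K : nat) : 0 < x < (/ 2) ^ K ->
  exists n, (/ 2) ^ (S n + K) <= x < (/ 2) ^ (n + K).
Proof.
  intros [H0 H1]. destruct (half_pow_small x H0) as [N HN].
  assert (HN' : (/ 2) ^ (N + K) <= x)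
    by (pose proof (half_pow_le N (N + K) ltac:(lia)); lra).
  clear HN. induction N as [|N IH]; [simpl in HN'; lra|].
  destruct (Rle_lt_dec ((/ 2) ^ (N + K)) x) as [H|H]; [apply IH, H|].
  exists N. split; assumption.
Qed.

Lemma sum_half_pow (N : nat) : sum_f_R0 (fun k => (/ 2) ^ (k + 3)) N <= / 4.
Proof.
  assert (H : sum_f_R0 (fun k => (/ 2) ^ (k + 3)) N = / 4 - (/ 2) ^ (N + 3)).
  { induction N as [|N IH]; [simpl; lra|]. rewrite tech5, IH.
    change (S N + 3)%nat with (S (N + 3)). simpl. lra. }
  pose proof (half_pow_pos (N + 3)). lra.
Qed.

(** Mass distribution argument. A set of diameter below 2^-(n+K) meets the Cantor set within one
    cylinder of length [2 * a n], because an empty slot occurs among the [K] slots from [n] on; the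
    gap affects only the constant. *)
Lemma cset_not_null a theta K s : rank_function a -> rank_density a theta -> bounded_gaps a K ->
  0 < theta -> 0 < s -> s < 2 * theta -> ~ Hnull s (cset a).
Proof.
  intros Ha Hd Hgap Hth Hs Hst Hnull.
  (* Chosen so that 2^(2 - 2 theta n) = C (2^-(n+1+K))^(2 theta), where 2^-(n+1+K) is the lower
     bound for the diameter given by [dyadic_scale]. *)
  set (C := Rpower 2 (2 + 2 * theta * (INR K + 1))).
  assert (HC : 0 < C) by apply exp_pos.
  assert (Hmass : forall n, (/ 2) ^ (2 * a n) <= Rpower 2 (2 - 2 * theta * INR n)).
  { intros n. rewrite half_pow_Rpower. apply Rle_Rpower; [lra|].
    rewrite mult_INR. replace (INR 2) with 2 by (simpl; ring). destruct (Hd n) as [H _]. nra. }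
  (* The error [eta] pays for sets of diameter 0, which determine no scale; any sufficiently long
     cylinder serves for them. *)
  assert (Hlen : forall d eta, 0 <= d < (/ 2) ^ K -> 0 < eta ->
            exists n, d < (/ 2) ^ (n + K) /\ (/ 2) ^ (2 * a n) <= C * powr d s + eta).
  { intros d eta [Hd0 Hd1] Heta. destruct (Rle_lt_or_eq_dec 0 d Hd0) as [Hdp|<-].
    - destruct (dyadic_scale d K (conj Hdp Hd1)) as (n & Hn1 & Hn2). exists n. split; [exact Hn2|].
      rewrite powr_pos_eq by exact Hdp.
      assert (Hd1' : d < 1)
        by (pose proof (half_pow_le 0 (n + K) ltac:(lia)) as Hh; simpl in Hh; lra).
      assert (Rpower 2 (2 - 2 * theta * INR n) <= C * Rpower d s); [|specialize (Hmass n); lra].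
      apply Rle_trans with (C * Rpower ((/ 2) ^ (S n + K)) (2 * theta)).
      + unfold C. rewrite half_pow_Rpower, Rpower_mult, <- Rpower_plus.
        apply Rle_Rpower; [lra|]. rewrite plus_INR, S_INR. lra.
      + apply Rmult_le_compat_l; [lra|].
        apply Rle_trans with (Rpower d (2 * theta)).
        * apply Rle_Rpower_l; [lra|]. split; [apply half_pow_pos|exact Hn1].
        * unfold Rpower. assert (ln d < 0) by (rewrite <- ln_1; apply ln_increasing; lra).
          left. apply exp_increasing. nra.
    - destruct (two_powers_small 2 (2 * theta) eta) as [n Hn]; [lra|exact Heta|].
      exists n. split; [apply half_pow_pos|]. rewrite powr_0.
      specialize (Hn n (le_n n)). specialize (Hmass n). lra. }
  (* The budget of 1/2 is split: a quarter for [C] times the power sum, a quarter for the errors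
     2^-(k+3). *)
  destruct (Hnull ((/ 2) ^ S K) (/ (4 * C))) as (U & d & Hcov & Hdd & Hdiam & Hsum).
  { apply half_pow_pos. }
  { apply Rinv_0_lt_compat. lra. }
  assert (Hn : forall k, exists n, d k < (/ 2) ^ (n + K) /\
                 (/ 2) ^ (2 * a n) <= C * powr (d k) s + (/ 2) ^ (k + 3)).
  { intros k. apply Hlen; [|apply half_pow_pos].
    specialize (Hdd k). pose proof (half_pow_pos K). simpl in Hdd. split; lra. }
  apply functional_choice in Hn. destruct Hn as [n Hn].
  assert (Hz : forall k, exists z, (exists z', U k (cpt a z')) -> U k (cpt a z)).
  { intros k. destruct (classic (exists z', U k (cpt a z'))) as [[z H]|H].
    - exists z. tauto.
    - exists (fun _ => false). tauto. }
  apply functional_choice in Hz. destruct Hz as [zk Hz].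
  destruct (cantor_uncovered zk (fun k => (2 * a (n k))%nat)) as [z Hun].
  - intros N. apply Rle_trans with (sum_f_R0 (fun k => C * powr (d k) s + (/ 2) ^ (k + 3)) N).
    + apply sum_Rle. intros k _. apply Hn.
    + rewrite plus_sum, (sum_eq _ (fun k => powr (d k) s * C)), <- scal_sum by (intros; ring).
      pose proof (sum_half_pow N).
      specialize (Hsum N). apply (Rmult_le_compat_l C) in Hsum; [|lra].
      replace (C * / (4 * C)) with (/ 4) in Hsum by (field; lra). lra.
  - destruct (Hcov (cpt a z)) as [k Hk]; [exists z; reflexivity|].
    apply (Hun k). destruct (Hgap (n k)) as (m & Hm & Hsl).
    apply (cpt_separated a _ _ (n k) m); try assumption; [lia|].
    eapply Rle_lt_trans; [apply (Hdiam k); [exact Hk|apply Hz; exists z; exact Hk]|].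
    eapply Rlt_le_trans; [apply Hn|]. apply half_pow_le. lia.
Qed.

Lemma hdim_eq_intro A h : (forall s, 0 < s -> h < s -> Hnull s A) ->
  (forall s, 0 < s -> s < h -> ~ Hnull s A) -> 0 <= h -> hdim_eq A h.
Proof.
  intros H1 H2 Hh. split.
  - intros s Hs HN. apply Rnot_lt_le. intros Hlt. exact (H2 s Hs Hlt HN).
  - intros b Hb. apply Rnot_lt_le. intros Hlt.
    specialize (Hb ((b + h) / 2) ltac:(lra) (H1 ((b + h) / 2) ltac:(lra) ltac:(lra))). lra.
Qed.

Lemma cset_dim a theta K : rank_function a -> rank_density a theta -> bounded_gaps a K ->
  0 < theta -> hdim_eq (cset a) (2 * theta).
Proof.
  intros Ha Hd Hg Hth. apply hdim_eq_intro; [| |lra].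
  - intros s Hs Hlt. apply cset_null with theta; assumption.
  - intros s Hs Hlt. apply cset_not_null with theta K; assumption.
Qed.

(** For the rank floor(theta n), a run of [K] used slots would raise the rank by [K], whereas the
    density allows less than theta K + 1. This is impossible once K > 1 / (1 - theta). *)
Lemma rank_exists (theta : R) : 0 < theta < 1 ->
  exists a K, rank_function a /\ rank_density a theta /\ bounded_gaps a K.
Proof.
  intros Hth. set (a := fun n => Z.to_nat (Int_part (theta * INR n))).
  assert (Hd : rank_density a theta).
  { intros n. pose proof (pos_INR n). pose proof (base_Int_part (theta * INR n)) as [H1 H2].
    assert (Hz : (-1 < Int_part (theta * INR n))%Z).
    { apply lt_IZR. simpl. nra. }
    unfold a. rewrite (INR_IZR_INZ (Z.to_nat _)), Z2Nat.id by lia. lra. }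
  assert (Hf : rank_function a).
  { split.
    - destruct (Hd O) as [_ H]. rewrite Rmult_0_r in H. change 0 with (INR 0) in H.
      apply INR_le in H. lia.
    - intros n. destruct (Hd n) as [H1 H2]. destruct (Hd (S n)) as [H3 H4]. rewrite S_INR in H3, H4.
      assert (INR (a (S n)) < INR (a n + 2)) by (rewrite plus_INR; simpl; lra).
      assert (INR (a n) < INR (a (S n) + 1)) by (rewrite plus_INR; simpl; lra).
      apply INR_lt in H, H0. lia. }
  destruct (INR_unbounded (1 / (1 - theta))) as [K HK].
  assert (HK' : theta * INR K + 1 < INR K).
  { apply (Rmult_lt_compat_l (1 - theta)) in HK; [|lra].
    replace ((1 - theta) * (1 / (1 - theta))) with 1 in HK by (field; lra). lra. }
  exists a, K. repeat split; try apply Hd; try apply Hf. intros n.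
  apply NNPP. intros Hno.
  assert (Hall : forall j, (j <= K)%nat -> a (n + j)%nat = (a n + j)%nat).
  { induction j as [|j IH]; intros Hj; [rewrite !Nat.add_0_r; reflexivity|].
    rewrite Nat.add_succ_r. destruct (proj2 Hf (n + j)%nat) as [E|E].
    - exfalso. apply Hno. exists (n + j)%nat. split; [lia|]. apply slot_false, E.
    - rewrite E, IH; lia. }
  specialize (Hall K (le_n K)). destruct (Hd n) as [H1 _]. destruct (Hd (n + K)%nat) as [_ H2].
  rewrite Hall, !plus_INR in H2. nra.
Qed.

(** * Bi-Lipschitz invariance of the dimension *)

Lemma powr_mult L d s : 0 < L -> 0 <= d -> powr (L * d) s = Rpower L s * powr d s.
Proof.
  intros HL Hd. destruct (Rle_lt_or_eq_dec 0 d Hd) as [Hp|<-].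
  - rewrite !powr_pos_eq by (try apply Rmult_lt_0_compat; assumption).
    symmetry. apply Rpower_mult_distr; assumption.
  - rewrite Rmult_0_r, powr_0. ring.
Qed.

(** Stated for a relation so that it serves a bi-Lipschitz map in both directions without
    constructing an inverse. *)
Lemma Hnull_transfer (A B : pt -> Prop) (rel : pt -> pt -> Prop) (L s : R) : 0 < L ->
  (forall y, B y -> exists x, A x /\ rel x y) ->
  (forall x x' y y', rel x y -> rel x' y' -> dist2 y y' <= L * dist2 x x') ->
  Hnull s A -> Hnull s B.
Proof.
  intros HL Hsurj Hlip HA delta eps Hdelta Heps.
  assert (HLs : 0 < Rpower L s) by apply exp_pos.
  destruct (HA (delta / L) (eps / Rpower L s)) as (U & d & H1 & H2 & H3 & H4).
  { apply Rdiv_lt_0_compat; lra. }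
  { apply Rdiv_lt_0_compat; lra. }
  exists (fun n y => exists x, U n x /\ rel x y), (fun n => L * d n). repeat split.
  - intros y Hy. destruct (Hsurj y Hy) as (x & Hx & Hr). destruct (H1 x Hx) as [n Hn].
    exists n, x. tauto.
  - apply Rmult_le_pos; [lra|apply H2].
  - destruct (H2 n) as [_ H]. apply (Rmult_le_compat_l L) in H; [|lra].
    replace (L * (delta / L)) with delta in H by (field; lra). exact H.
  - intros n y y' (x & Hx & Hr) (x' & Hx' & Hr').
    apply Rle_trans with (L * dist2 x x'); [apply Hlip; assumption|].
    apply Rmult_le_compat_l; [lra|]. apply H3; assumption.
  - intros N. rewrite (sum_eq _ (fun k => powr (d k) s * Rpower L s)).
    2:{ intros k _. rewrite powr_mult; [ring|exact HL|apply H2]. }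
    rewrite <- scal_sum. specialize (H4 N). apply (Rmult_le_compat_l (Rpower L s)) in H4; [|lra].
    replace (Rpower L s * (eps / Rpower L s)) with eps in H4 by (field; lra). exact H4.
Qed.

Definition bilipschitz (f : pt -> pt) : Prop :=
  exists L, 0 < L /\ forall p q, dist2 (f p) (f q) <= L * dist2 p q /\
                                 dist2 p q <= L * dist2 (f p) (f q).

Lemma bilipschitz_comp f g : bilipschitz f -> bilipschitz g -> bilipschitz (fun p => g (f p)).
Proof.
  intros (L & HL & Hf) (M & HM & Hg). exists (M * L).
  split; [apply Rmult_lt_0_compat; assumption|]. intros p q.
  destruct (Hf p q) as [H1 H2]. destruct (Hg (f p) (f q)) as [H3 H4]. split.
  - apply (Rmult_le_compat_l M) in H1; lra.
  - apply (Rmult_le_compat_l L) in H4; lra.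
Qed.

Lemma hdim_bilipschitz f A h : bilipschitz f -> hdim_eq A h -> hdim_eq (image f A) h.
Proof.
  intros (L & HL & Hf) [H1 H2]. split.
  - intros s Hs HN. apply H1; [exact Hs|].
    apply (Hnull_transfer (image f A) A (fun x y => x = f y) L s HL); [| |exact HN].
    + intros y Hy. exists (f y). split; [exists y; tauto|reflexivity].
    + intros x x' y y' -> ->. apply Hf.
  - intros b Hb. apply H2. intros s Hs HN. apply Hb; [exact Hs|].
    apply (Hnull_transfer A (image f A) (fun x y => y = f x) L s HL); [| |exact HN].
    + intros y [x [Hx ->]]. exists x. tauto.
    + intros x x' y y' -> ->. apply Hf.
Qed.

(** * Shears *)

Definition lipschitz1 (f : R -> R) : Prop :=
  exists L, 0 <= L /\ forall x y, Rabs (f x - f y) <= L * Rabs (x - y).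

Lemma lipschitz1_scal c f : lipschitz1 f -> lipschitz1 (fun x => c * f x).
Proof.
  intros (L & HL & Hf). exists (Rabs c * L). split.
  - apply Rmult_le_pos; [apply Rabs_pos|exact HL].
  - intros x y. rewrite <- Rmult_minus_distr_l, Rabs_mult, Rmult_assoc.
    apply Rmult_le_compat_l; [apply Rabs_pos|apply Hf].
Qed.

Lemma lipschitz1_plus f g : lipschitz1 f -> lipschitz1 g -> lipschitz1 (fun x => f x + g x).
Proof.
  intros (L & HL & Hf) (M & HM & Hg). exists (L + M). split; [lra|].
  intros x y. replace (f x + g x - (f y + g y)) with ((f x - f y) + (g x - g y)) by ring.
  eapply Rle_trans; [apply Rabs_triang|]. specialize (Hf x y). specialize (Hg x y). lra.
Qed.

(* [d = true] is a horizontal shear, [d = false] a vertical one. *)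
Definition shear_x (d : bool) (f : R -> R) (p : pt) : R := if d then f (snd p) else 0.
Definition shear_y (d : bool) (f : R -> R) (p : pt) : R := if d then 0 else f (fst p).
Definition shear (d : bool) (f : R -> R) (c : R) (p : pt) : pt :=
  (fst p + c * shear_x d f p, snd p + c * shear_y d f p).

(** A shear does not move the coordinate that it reads. Hence reversing the sign of [c] inverts it,
    and a point carried by it has constant profile value. *)
Lemma shear_field_invariant d f c p :
  shear_x d f (shear d f c p) = shear_x d f p /\ shear_y d f (shear d f c p) = shear_y d f p.
Proof.
  destruct d; unfold shear, shear_x, shear_y; simpl; rewrite Rmult_0_r, Rplus_0_r; auto.
Qed.

Lemma shear_inv d f c p : shear d f (- c) (shear d f c p) = p.
Proof.
  unfold shear at 1. destruct (shear_field_invariant d f c p) as [-> ->].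
  destruct p as [x y]. unfold shear; simpl. f_equal; ring.
Qed.

Lemma shear_lipschitz d f c : lipschitz1 f ->
  exists L, 0 < L /\ forall p q, dist2 (shear d f c p) (shear d f c q) <= L * dist2 p q.
Proof.
  intros (L & HL & Hf). exists (2 + Rabs c * L).
  assert (HcL : 0 <= Rabs c * L) by (apply Rmult_le_pos; [apply Rabs_pos|exact HL]).
  split; [lra|]. intros p q.
  eapply Rle_trans; [apply dist2_le_sum|].
  pose proof (dist2_fst p q) as Hx. pose proof (dist2_snd p q) as Hy.
  assert (Hc : forall u v, Rabs (c * f u - c * f v) <= Rabs c * L * Rabs (u - v)).
  { intros u v. rewrite <- Rmult_minus_distr_l, Rabs_mult, Rmult_assoc.
    apply Rmult_le_compat_l; [apply Rabs_pos|apply Hf]. }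
  destruct d; unfold shear, shear_x, shear_y; simpl fst; simpl snd; rewrite !Rmult_0_r, !Rplus_0_r.
  - replace (fst p + c * f (snd p) - (fst q + c * f (snd q)))
      with ((fst p - fst q) + (c * f (snd p) - c * f (snd q))) by ring.
    pose proof (Rabs_triang (fst p - fst q) (c * f (snd p) - c * f (snd q))).
    specialize (Hc (snd p) (snd q)).
    pose proof (Rmult_le_compat_l (Rabs c * L) _ _ HcL Hy). lra.
  - replace (snd p + c * f (fst p) - (snd q + c * f (fst q)))
      with ((snd p - snd q) + (c * f (fst p) - c * f (fst q))) by ring.
    pose proof (Rabs_triang (snd p - snd q) (c * f (fst p) - c * f (fst q))).
    specialize (Hc (fst p) (fst q)).
    pose proof (Rmult_le_compat_l (Rabs c * L) _ _ HcL Hx). lra.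
Qed.

Lemma shear_bilipschitz d f c : lipschitz1 f -> bilipschitz (shear d f c).
Proof.
  intros Hf. destruct (shear_lipschitz d f c Hf) as (L & HL & H1).
  destruct (shear_lipschitz d f (- c) Hf) as (M & HM & H2).
  exists (L + M). split; [lra|]. intros p q.
  pose proof (dist2_pos p q). pose proof (dist2_pos (shear d f c p) (shear d f c q)). split.
  - specialize (H1 p q). nra.
  - specialize (H2 (shear d f c p) (shear d f c q)). rewrite !shear_inv in H2. nra.
Qed.

(** * Emptying one digit slot by three shears *)

Definition cantor (A : nat -> Prop) (x : R) : Prop :=
  exists b, x = val b /\ forall l, b l = true -> A l.

Definition coinfinite (A : nat -> Prop) : Prop := forall n, exists m, (n < m)%nat /\ ~ A m.

(** Distance to a set. For empty [Z] the infimum is infinite and [Rbar.real] sends it to 0, hence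
    the nonemptiness assumptions below. *)
Definition inf_dist (Z : R -> Prop) (x : R) : R :=
  Rbar.real (Glb_Rbar (fun r => exists z, Z z /\ r = Rabs (x - z))).

Lemma inf_dist_spec (Z : R -> Prop) (x : R) : (exists z, Z z) ->
  (forall z, Z z -> inf_dist Z x <= Rabs (x - z)) /\
  (forall r, (forall z, Z z -> r <= Rabs (x - z)) -> r <= inf_dist Z x).
Proof.
  intros [z0 Hz0]. unfold inf_dist.
  destruct (Glb_Rbar_correct (fun r => exists z, Z z /\ r = Rabs (x - z))) as [H1 H2].
  set (g := Glb_Rbar _) in *.
  assert (H0 : Rbar_le 0 g).
  { apply H2. intros r (z & _ & ->). simpl. apply Rabs_pos. }
  assert (H0' : Rbar_le g (Rabs (x - z0))) by (apply H1; exists z0; tauto).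
  destruct g as [g| |]; simpl in H0, H0'; try contradiction. simpl. split.
  - intros z Hz. apply (H1 (Rabs (x - z))). exists z. tauto.
  - intros r Hr. apply (H2 r). intros r' (z & Hz & ->). simpl. apply Hr, Hz.
Qed.

Lemma inf_dist_lipschitz Z x y : (exists z, Z z) ->
  Rabs (inf_dist Z x - inf_dist Z y) <= Rabs (x - y).
Proof.
  intros HZ.
  assert (H : forall u v, inf_dist Z u - Rabs (u - v) <= inf_dist Z v).
  { intros u v. apply (proj2 (inf_dist_spec Z v HZ)). intros z Hz.
    pose proof (proj1 (inf_dist_spec Z u HZ) z Hz).
    pose proof (Rabs_triang (u - v) (v - z)) as Ht.
    replace (u - v + (v - z)) with (u - z) in Ht by ring. lra. }
  pose proof (H x y). pose proof (H y x) as H'. rewrite (Rabs_minus_sym y x) in H'.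
  apply Rabs_le. lra.
Qed.

Lemma Rmin_lipschitz c u v : Rabs (Rmin c u - Rmin c v) <= Rabs (u - v).
Proof.
  unfold Rmin. destruct Rle_dec, Rle_dec; unfold Rabs; repeat destruct Rcase_abs; lra.
Qed.

(** With a free slot [m] > [i], points whose digits [i] differ are at least 2^-(m+1) apart. The
    distance to the points with digit 0, divided by this gap and cut off at 1, is a Lipschitz
    extension of the digit to the line. *)
Lemma digit_reader (A : nat -> Prop) (i : nat) : coinfinite A ->
  exists g, lipschitz1 g /\ (forall x, 0 <= g x <= 1) /\
    forall b, (forall l, b l = true -> A l) -> g (val b) = if b i then 1 else 0.
Proof.
  intros HA. destruct (HA i) as (m & Him & HmA).
  set (Z := fun x => exists b, x = val b /\ (forall l, b l = true -> A l) /\ b i = false).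
  assert (HZ : exists z, Z z).
  { exists (val (fun _ => false)), (fun _ => false). repeat split; discriminate. }
  pose proof (half_pow_pos (S m)) as Hp.
  assert (Hpi : 0 < / (/ 2) ^ S m) by (apply Rinv_0_lt_compat; exact Hp).
  assert (Hd0 : forall x, 0 <= inf_dist Z x).
  { intros x. apply (inf_dist_spec Z x HZ). intros; apply Rabs_pos. }
  exists (fun x => Rmin 1 (/ (/ 2) ^ S m * inf_dist Z x)). repeat split.
  - exists (/ (/ 2) ^ S m). split; [lra|]. intros x y.
    eapply Rle_trans; [apply Rmin_lipschitz|].
    rewrite <- Rmult_minus_distr_l, Rabs_mult, (Rabs_pos_eq (/ _)) by lra.
    apply Rmult_le_compat_l; [lra|]. apply inf_dist_lipschitz, HZ.
  - apply Rmin_glb; [lra|]. apply Rmult_le_pos; [lra|apply Hd0].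
  - apply Rmin_l.
  - intros b Hb. destruct (b i) eqn:Ei.
    + apply Rmin_left.
      assert (H : (/ 2) ^ S m <= inf_dist Z (val b)).
      { apply (inf_dist_spec Z (val b) HZ). intros z (c & -> & Hc & Hci).
        apply (val_sep i); [exact Him| | |congruence].
        - destruct (b m) eqn:E; [exfalso; apply HmA, Hb, E|reflexivity].
        - destruct (c m) eqn:E; [exfalso; apply HmA, Hc, E|reflexivity]. }
      apply (Rmult_le_compat_l (/ (/ 2) ^ S m)) in H; [|lra].
      rewrite Rinv_l in H; lra.
    + assert (H : inf_dist Z (val b) = 0).
      { apply Rle_antisym; [|apply Hd0].
        replace 0 with (Rabs (val b - val b)) by (rewrite Rminus_diag; apply Rabs_R0).
        apply (inf_dist_spec Z (val b) HZ). exists b. tauto. }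
      rewrite H, Rmult_0_r. apply Rmin_right. lra.
Qed.

Lemma coinfinite_swap A k j : coinfinite A -> coinfinite (fun l => A l \/ l = k \/ l = j).
Proof.
  intros HA n. destruct (HA (n + k + j)%nat) as (m & Hm & H). exists m.
  split; [lia|]. intros [H'|[H'|H']]; [tauto|lia|lia].
Qed.

Definition cantor2 (A : nat -> Prop) (p : pt) : Prop := cantor A (fst p) /\ cantor A (snd p).

(** The first shear copies x_k into y_j. The second copies y_k into x_j and cancels x_k by reading
    its copy y_j. The third cancels y_k by reading its copy x_j. *)
Lemma empty_slot (A : nat -> Prop) (k : nat) : coinfinite A ->
  (forall l, (l < k)%nat -> ~ A l) ->
  exists (A' : nat -> Prop) (f0 f1 f2 : R -> R),
    (coinfinite A' /\ forall l, (l < S k)%nat -> ~ A' l) /\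
    (lipschitz1 f0 /\ lipschitz1 f1 /\ lipschitz1 f2) /\
    (forall x, Rabs (f0 x) <= (/ 2) ^ k /\ Rabs (f1 x) <= (/ 2) ^ k /\ Rabs (f2 x) <= (/ 2) ^ k) /\
    forall p, cantor2 A p ->
      cantor2 A' (shear false f2 1 (shear true f1 1 (shear false f0 1 p))).
Proof.
  intros HA Hk. destruct (HA k) as (j & Hkj & HjA).
  (* At intermediate stages both [k] and [j] may be occupied, so the readers are built for the
     larger slot set [D]. *)
  set (D := fun l => A l \/ l = k \/ l = j).
  assert (HD : coinfinite D) by (apply coinfinite_swap, HA).
  destruct (digit_reader D k HD) as (gk & Lk & Bk & Rk).
  destruct (digit_reader D j HD) as (gj & Lj & Bj & Rj).
  set (u := (/ 2) ^ S k). set (v := (/ 2) ^ S j).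
  assert (Hu : 0 < u) by apply half_pow_pos. assert (Hv : 0 < v) by apply half_pow_pos.
  assert (Huv : v <= u) by (apply half_pow_le; lia).
  assert (Hu2 : (/ 2) ^ k = 2 * u) by (unfold u; simpl; field).
  exists (fun l => D l /\ l <> k).
  exists (fun x => v * gk x), (fun y => - u * gj y + v * gk y), (fun x => - u * gj x).
  split; [|split; [|split]].
  - split.
    + intros n. destruct (HD n) as (m & Hm & H). exists m. tauto.
    + intros l Hl [[H|[H|H]] Hn]; [|lia|lia]. apply (Hk l); [lia|exact H].
  - repeat split; try apply lipschitz1_plus; apply lipschitz1_scal; assumption.
  - intros x. rewrite Hu2. specialize (Bk x). specialize (Bj x).
    repeat split; apply Rabs_le; nra.
  - intros [x y] [(b & Hx & Hb) (c & Hy & Hc)]. simpl in Hx, Hy.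
    assert (Hsupp : forall b0 s t, (forall l, b0 l = true -> A l) ->
              forall l, upd (upd b0 k s) j t l = true -> D l).
    { intros b0 s t Hb0 l. unfold D, upd. destruct (Nat.eqb_spec l j); [tauto|].
      destruct (Nat.eqb_spec l k); [tauto|]. intros H; left; apply Hb0, H. }
    assert (Hval : forall b0 s t,
              val (upd (upd b0 k s) j t)
              = val (upd (upd b0 k false) j false) + (if s then u else 0) + (if t then v else 0)).
    { intros b0 s t. rewrite val_upd.
      rewrite (val_ext (upd (upd b0 k s) j false) (upd (upd b0 j false) k s)),
              (val_ext (upd (upd b0 k false) j false) (upd (upd b0 j false) k false)).
      - rewrite (val_upd k _ s). reflexivity.
      - intros l. unfold upd. destruct (Nat.eqb_spec l j), (Nat.eqb_spec l k); try reflexivity; lia.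
      - intros l. unfold upd. destruct (Nat.eqb_spec l j), (Nat.eqb_spec l k); try reflexivity; lia. }
    (* As slot [j] is free, each initial expansion is already of the updated form that [Hval] and
       [Hread] treat. *)
    assert (Hself : forall b0, (forall l, b0 l = true -> A l) ->
              val b0 = val (upd (upd b0 k (b0 k)) j false)).
    { intros b0 Hb0. apply val_ext. intros l. unfold upd.
      destruct (Nat.eqb_spec l j) as [->|].
      - destruct (b0 j) eqn:E; [exfalso; apply HjA, Hb0, E|reflexivity].
      - destruct (Nat.eqb_spec l k) as [->|]; reflexivity. }
    assert (Hread : forall b0 s t, (forall l, b0 l = true -> A l) ->
              gk (val (upd (upd b0 k s) j t)) = (if s then 1 else 0) /\
              gj (val (upd (upd b0 k s) j t)) = (if t then 1 else 0)).
    { intros b0 s t Hb0. rewrite Rk, Rj by (apply Hsupp, Hb0).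
      rewrite upd_eq, upd_neq, upd_eq by lia. tauto. }
    rewrite (Hself b Hb) in Hx. rewrite (Hself c Hc) in Hy.
    set (e := b k) in *. set (f := c k) in *.
    assert (E0 : shear false (fun x => v * gk x) 1 (x, y)
                 = (x, val (upd (upd c k f) j e))).
    { unfold shear, shear_x, shear_y; simpl. f_equal; [ring|].
      rewrite Hx, Hy, (proj1 (Hread b e false Hb)), (Hval c f false), (Hval c f e).
      destruct e; ring. }
    assert (E1 : shear true (fun y => - u * gj y + v * gk y) 1 (x, val (upd (upd c k f) j e))
                 = (val (upd (upd b k false) j f), val (upd (upd c k f) j e))).
    { unfold shear, shear_x, shear_y; simpl. f_equal; [|ring].
      destruct (Hread c f e Hc) as [-> ->].
      rewrite Hx, (Hval b e false), (Hval b false f). destruct e, f; ring. }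
    assert (E2 : shear false (fun x => - u * gj x) 1
                   (val (upd (upd b k false) j f), val (upd (upd c k f) j e))
                 = (val (upd (upd b k false) j f), val (upd (upd c k false) j e))).
    { unfold shear, shear_x, shear_y; simpl. f_equal; [ring|].
      rewrite (proj2 (Hread b false f Hb)).
      rewrite (Hval c f e), (Hval c false e). destruct e, f; ring. }
    rewrite E0, E1, E2.
    assert (Hfin : forall b0 t, (forall l, b0 l = true -> A l) ->
              cantor (fun l => D l /\ l <> k) (val (upd (upd b0 k false) j t))).
    { intros b0 t Hb0. exists (upd (upd b0 k false) j t). split; [reflexivity|].
      intros l Hl. split; [apply (Hsupp b0 false t Hb0 l Hl)|].
      intros ->. rewrite upd_neq, upd_eq in Hl by lia. discriminate. }
    split; simpl; apply Hfin; assumption.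
Qed.

Lemma cantor_small A k x : (forall l, (l < k)%nat -> ~ A l) -> cantor A x ->
  Rabs x <= (/ 2) ^ k.
Proof.
  intros HA (b & -> & Hb). rewrite <- (Rminus_0_r (val b)), <- val_zero.
  apply val_agree. intros l Hl. destruct (b l) eqn:E; [|reflexivity].
  exfalso. apply (HA l Hl), Hb, E.
Qed.

(** * Termwise limits of normally convergent series *)

Lemma series_tail_small (M : nat -> R) (eps : R) : ex_series M -> 0 < eps ->
  exists N, forall n, (N <= n)%nat -> Rabs (Series M - sum_f_R0 M n) < eps.
Proof.
  intros HM He. pose proof (Series_correct M HM) as H.
  apply is_series_Reals in H. destruct (H eps He) as [N HN]. exists N. intros n Hn.
  rewrite Rabs_minus_sym. apply HN, Hn.
Qed.

Lemma ex_series_dominated (a M : nat -> R) : (forall n, Rabs (a n) <= M n) -> ex_series M ->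
  ex_series a.
Proof. intros Ha HM. exact (ex_series_le (V := R_CompleteNormedModule) a M Ha HM). Qed.

Lemma Series_dominated (a M : nat -> R) : (forall n, Rabs (a n) <= M n) -> ex_series M ->
  Rabs (Series a) <= Series M.
Proof.
  intros Ha HM. eapply Rle_trans.
  - apply Series_Rabs, (ex_series_dominated _ M); [|exact HM].
    intros n. rewrite Rabs_Rabsolu. apply Ha.
  - apply Series_le; [|exact HM]. intros n. split; [apply Rabs_pos|apply Ha].
Qed.

Lemma Series_split (a : nat -> R) (N : nat) : ex_series a ->
  Series a = sum_f_R0 a N + Series (fun k => a (S N + k)%nat).
Proof. intros Ha. apply (Series_incr_n a (S N)); [lia|exact Ha]. Qed.

Lemma ex_series_tail (a : nat -> R) (N : nat) : ex_series a ->
  ex_series (fun k => a (S N + k)%nat).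
Proof. intros Ha. apply (ex_series_incr_n a (S N)), Ha. Qed.

Lemma tail_exists (M : nat -> R) (eps : R) : ex_series M -> 0 < eps ->
  exists N, Series (fun k => M (S N + k)%nat) < eps.
Proof.
  intros HM He. destruct (series_tail_small M eps HM He) as [N HN]. exists N.
  specialize (HN N (le_n N)). rewrite (Series_split M N HM) in HN.
  replace (_ + _ - _) with (Series (fun k => M (S N + k)%nat)) in HN by ring.
  eapply Rle_lt_trans; [apply Rle_abs|exact HN].
Qed.

Lemma derivable_pt_lim_sum (g g' : nat -> R -> R) (N : nat) (t : R) :
  (forall n, derivable_pt_lim (g n) t (g' n t)) ->
  derivable_pt_lim (fun s => sum_f_R0 (fun n => g n s) N) t (sum_f_R0 (fun n => g' n t) N).
Proof.
  intros H. induction N as [|N IH]; [apply H|].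
  exact (derivable_pt_lim_plus (fun s => sum_f_R0 (fun n => g n s) N) (g (S N)) t _ _ IH (H (S N))).
Qed.

(** The Lipschitz bounds control the difference quotients of the tail by the tail of [M], uniformly
    in the increment, so only a finite sum has to be differentiated. *)
Lemma series_derivable (g g' : nat -> R -> R) (M : nat -> R) : ex_series M ->
  (forall n t, derivable_pt_lim (g n) t (g' n t)) ->
  (forall n s t, Rabs (g n s - g n t) <= M n * Rabs (s - t)) ->
  (forall n t, Rabs (g' n t) <= M n) ->
  (forall t, ex_series (fun n => g n t)) ->
  forall t, derivable_pt_lim (fun s => Series (fun n => g n s)) t (Series (fun n => g' n t)).
Proof.
  intros HM Hd Hl Hb Hex t eps He.
  (* One quarter for the tail of the quotients, one for the tail of the derivatives; the finite sum
     gets the remaining half. *)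
  destruct (tail_exists M (eps / 4) HM) as [N HN]; [lra|].
  destruct (derivable_pt_lim_sum g g' N t (fun n => Hd n t) (eps / 2)) as [delta Hdelta]; [lra|].
  exists delta. intros k Hk0 Hk. specialize (Hdelta k Hk0 Hk).
  pose proof (ex_series_tail M N HM) as HMt.
  assert (Hg' : ex_series (fun n => g' n t)) by (apply (ex_series_dominated _ M); auto).
  rewrite (Series_split _ N (Hex (t + k))), (Series_split _ N (Hex t)), (Series_split _ N Hg').
  assert (H1 : Rabs (Series (fun j => g (S N + j)%nat (t + k)) - Series (fun j => g (S N + j)%nat t))
               <= Rabs k * Series (fun j => M (S N + j)%nat)).
  { rewrite <- Series_minus by (apply (ex_series_tail (fun n => g n _)); apply Hex).
    rewrite <- Series_scal_l. apply Series_dominated.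
    - intros n. specialize (Hl (S N + n)%nat (t + k) t).
      replace (t + k - t) with k in Hl by ring. rewrite Rmult_comm. exact Hl.
    - exact (ex_series_scal (V := R_NormedModule) (Rabs k) _ HMt). }
  assert (H2 : Rabs (Series (fun j => g' (S N + j)%nat t)) <= Series (fun j => M (S N + j)%nat))
    by (apply Series_dominated; auto).
  set (A := sum_f_R0 (fun n => g n (t + k)) N) in *. set (B := sum_f_R0 (fun n => g n t) N) in *.
  set (C := sum_f_R0 (fun n => g' n t) N) in *.
  set (A' := Series (fun j => g (S N + j)%nat (t + k))) in *.
  set (B' := Series (fun j => g (S N + j)%nat t)) in *.
  set (C' := Series (fun j => g' (S N + j)%nat t)) in *.
  replace ((A + A' - (B + B')) / k - (C + C')) with (((A - B) / k - C) + ((A' - B') / k - C'))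
    by (field; exact Hk0).
  assert (H3 : Rabs ((A' - B') / k) <= Series (fun j => M (S N + j)%nat)).
  { unfold Rdiv. rewrite Rabs_mult, Rabs_inv. pose proof (Rabs_pos_lt k Hk0).
    apply (Rmult_le_reg_r (Rabs k)); [assumption|].
    rewrite Rmult_assoc, Rinv_l by lra. lra. }
  pose proof (Rabs_triang ((A - B) / k - C) ((A' - B') / k - C')).
  pose proof (Rabs_triang ((A' - B') / k) (- C')) as H5. rewrite Rabs_Ropp in H5.
  unfold Rminus in *. lra.
Qed.

(** * Uniform continuity of normally convergent series *)

Definition ucont (w : R -> pt -> R) : Prop :=
  forall eps, eps > 0 -> exists delta, delta > 0 /\
    forall t s x y, 0 <= t <= 1 -> 0 <= s <= 1 ->
      Rabs (t - s) < delta -> dist2 x y < delta -> Rabs (w t x - w s y) < eps.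

Lemma ucont_lipschitz (w : R -> pt -> R) (L : R) : 0 <= L ->
  (forall t s x y, Rabs (w t x - w s y) <= L * (Rabs (t - s) + dist2 x y)) -> ucont w.
Proof.
  intros HL Hw eps He. exists (eps / (2 * (L + 1))).
  assert (Hd : 0 < eps / (2 * (L + 1))) by (apply Rdiv_lt_0_compat; lra).
  split; [exact Hd|]. intros t s x y _ _ H1 H2.
  eapply Rle_lt_trans; [apply Hw|].
  assert (E : (L + 1) * (eps / (2 * (L + 1)) + eps / (2 * (L + 1))) = eps) by (field; lra).
  pose proof (Rabs_pos (t - s)). pose proof (dist2_pos x y). nra.
Qed.

Lemma ucont_sum (w : nat -> R -> pt -> R) (N : nat) : (forall n, ucont (w n)) ->
  ucont (fun t p => sum_f_R0 (fun n => w n t p) N).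
Proof.
  intros Hw. induction N as [|N IH]; [apply Hw|]. intros eps He.
  destruct (IH (eps / 2)) as (d1 & Hd1 & H1); [lra|].
  destruct (Hw (S N) (eps / 2)) as (d2 & Hd2 & H2); [lra|].
  exists (Rmin d1 d2). split; [apply Rmin_glb_lt; assumption|].
  intros t s x y Ht Hs Hts Hxy. simpl.
  specialize (H1 t s x y Ht Hs (Rlt_le_trans _ _ _ Hts (Rmin_l _ _)) (Rlt_le_trans _ _ _ Hxy (Rmin_l _ _))).
  specialize (H2 t s x y Ht Hs (Rlt_le_trans _ _ _ Hts (Rmin_r _ _)) (Rlt_le_trans _ _ _ Hxy (Rmin_r _ _))).
  replace (_ - _) with ((sum_f_R0 (fun n => w n t x) N - sum_f_R0 (fun n => w n s y) N)
                        + (w (S N) t x - w (S N) s y)) by ring.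
  eapply Rle_lt_trans; [apply Rabs_triang|]. lra.
Qed.

Lemma ucont_series (w : nat -> R -> pt -> R) (M : nat -> R) : ex_series M ->
  (forall n, ucont (w n)) -> (forall n t p, Rabs (w n t p) <= M n) ->
  ucont (fun t p => Series (fun n => w n t p)).
Proof.
  intros HM Hw Hb eps He.
  destruct (tail_exists M (eps / 4) HM) as [N HN]; [lra|].
  destruct (ucont_sum w N Hw (eps / 2)) as (delta & Hd & H); [lra|].
  exists delta. split; [exact Hd|]. intros t s x y Ht Hs Hts Hxy.
  specialize (H t s x y Ht Hs Hts Hxy).
  assert (Hex : forall t p, ex_series (fun n => w n t p))
    by (intros; apply (ex_series_dominated _ M); auto).
  rewrite (Series_split _ N (Hex t x)), (Series_split _ N (Hex s y)).
  assert (Htail : forall t p, Rabs (Series (fun k => w (S N + k)%nat t p))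
                              <= Series (fun k => M (S N + k)%nat)).
  { intros. apply Series_dominated; auto. apply ex_series_tail, HM. }
  pose proof (Htail t x) as T1. pose proof (Htail s y) as T2.
  set (A := Series (fun k => w (S N + k)%nat t x)) in *.
  set (B := Series (fun k => w (S N + k)%nat s y)) in *.
  replace (_ - _) with ((sum_f_R0 (fun n => w n t x) N - sum_f_R0 (fun n => w n s y) N)
                        + (A - B)) by ring.
  eapply Rle_lt_trans; [apply Rabs_triang|].
  pose proof (Rabs_triang A (- B)) as T3. rewrite Rabs_Ropp in T3. unfold Rminus in *. lra.
Qed.

(** * Series with finitely many nonzero terms *)

Lemma sum_zero (a : nat -> R) (N : nat) : (forall n, (n <= N)%nat -> a n = 0) -> sum_f_R0 a N = 0.
Proof.
  intros Ha. rewrite (sum_eq a (fun _ => 0)) by exact Ha. rewrite sum_cte. ring.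
Qed.

Lemma Series_truncate (a : nat -> R) (N : nat) : (forall n, (N < n)%nat -> a n = 0) ->
  Series a = sum_f_R0 a N.
Proof.
  intros Ha.
  assert (Hz : forall k, a (S N + k)%nat = 0) by (intros; apply Ha; lia).
  rewrite (Series_split a N).
  - rewrite (Series_ext _ (fun _ => 0) Hz), Series_zero. ring.
  - apply (ex_series_incr_n a (S N)), (ex_series_ext (fun _ => 0)).
    + intros k. symmetry. apply Hz.
    + exists 0. apply is_series_Reals. intros eps He. exists O. intros n _.
      rewrite sum_zero by reflexivity. rewrite R_dist_eq. exact He.
Qed.

(** Unlike [sum_f_R0] it can be empty, which matches the recursion of [stage]. *)
Fixpoint psum (c : nat -> R) (n : nat) : R :=
  match n with O => 0 | S m => psum c m + c m end.

Lemma psum_S c n : psum c (S n) = sum_f_R0 c n.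
Proof. induction n as [|n IH]; simpl in *; [ring|]. rewrite IH. reflexivity. Qed.

Lemma Series_last (a : nat -> R) (N : nat) : (forall n, (N < n)%nat -> a n = 0) ->
  Series a = psum a N + a N.
Proof. intros Ha. rewrite (Series_truncate a N Ha), <- psum_S. reflexivity. Qed.

Lemma psum_ext a b N : (forall n, (n < N)%nat -> a n = b n) -> psum a N = psum b N.
Proof.
  induction N as [|N IH]; intros H; [reflexivity|]. simpl.
  rewrite IH, H by (intros; try apply H; lia). reflexivity.
Qed.

Lemma psum_zero N : psum (fun _ => 0) N = 0.
Proof. induction N as [|N IH]; simpl; [|rewrite IH]; ring. Qed.

(** * Time profiles *)

(** [tent] is the hat function on [0,1] of height 2 and integral 1, and [ramp] its primitive, rising
    from 0 to 1. In terms of truncated powers, estimates for both are linear combinations of those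
    for [Rmax 0]. *)
Definition tent (v : R) : R := 4 * (Rmax 0 v - 2 * Rmax 0 (v - / 2) + Rmax 0 (v - 1)).
Definition ramp (v : R) : R :=
  2 * (Rmax 0 v ^ 2 - 2 * Rmax 0 (v - / 2) ^ 2 + Rmax 0 (v - 1) ^ 2).

Ltac max_cases := unfold Rmax; repeat destruct Rle_dec.

Lemma tent_outside v : v <= 0 \/ 1 <= v -> tent v = 0.
Proof. unfold tent. intros [H|H]; max_cases; lra. Qed.

Lemma tent_bound v : 0 <= tent v <= 2.
Proof. unfold tent. max_cases; lra. Qed.

Lemma Rmax_lipschitz u v : Rabs (Rmax 0 u - Rmax 0 v) <= Rabs (u - v).
Proof. max_cases; unfold Rabs; repeat destruct Rcase_abs; lra. Qed.

Lemma tent_lipschitz u v : Rabs (tent u - tent v) <= 16 * Rabs (u - v).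
Proof.
  unfold tent. pose proof (Rmax_lipschitz u v) as H1.
  pose proof (Rmax_lipschitz (u - / 2) (v - / 2)) as H2.
  pose proof (Rmax_lipschitz (u - 1) (v - 1)) as H3.
  replace (u - / 2 - (v - / 2)) with (u - v) in H2 by ring.
  replace (u - 1 - (v - 1)) with (u - v) in H3 by ring.
  apply Rabs_le_between in H1, H2, H3. apply Rabs_le. lra.
Qed.

Lemma ramp_0 v : v <= 0 -> ramp v = 0.
Proof. unfold ramp. intros H; max_cases; nra. Qed.

Lemma ramp_1 v : 1 <= v -> ramp v = 1.
Proof. unfold ramp. intros H; max_cases; nra. Qed.

Lemma ramp_bound v : Rabs (ramp v) <= 1.
Proof. apply Rabs_le. unfold ramp. max_cases; nra. Qed.

Lemma Rmax_sq_taylor v k :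
  Rabs (Rmax 0 (v + k) ^ 2 - Rmax 0 v ^ 2 - k * (2 * Rmax 0 v)) <= k ^ 2.
Proof. apply Rabs_le. max_cases; nra. Qed.

Lemma ramp_taylor v k : Rabs (ramp (v + k) - ramp v - k * tent v) <= 8 * k ^ 2.
Proof.
  unfold ramp, tent. pose proof (Rmax_sq_taylor v k) as H1.
  pose proof (Rmax_sq_taylor (v - / 2) k) as H2. pose proof (Rmax_sq_taylor (v - 1) k) as H3.
  replace (v - / 2 + k) with (v + k - / 2) in H2 by ring.
  replace (v - 1 + k) with (v + k - 1) in H3 by ring.
  apply Rabs_le_between in H1, H2, H3. apply Rabs_le. lra.
Qed.

Lemma derivable_of_taylor (g : R -> R) (t l C : R) : 0 <= C ->
  (forall k, Rabs (g (t + k) - g t - k * l) <= C * k ^ 2) -> derivable_pt_lim g t l.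
Proof.
  intros HC H eps He. assert (Hd : 0 < eps / (C + 1)) by (apply Rdiv_lt_0_compat; lra).
  exists (mkposreal _ Hd). intros k Hk0 Hk. simpl in Hk. specialize (H k).
  pose proof (Rabs_pos_lt k Hk0) as Hkp.
  replace ((g (t + k) - g t) / k - l) with ((g (t + k) - g t - k * l) / k) by (field; exact Hk0).
  unfold Rdiv. rewrite Rabs_mult, Rabs_inv.
  apply (Rmult_lt_reg_r (Rabs k)); [exact Hkp|]. rewrite Rmult_assoc, Rinv_l, Rmult_1_r by lra.
  rewrite <- (pow2_abs k) in H.
  apply (Rmult_lt_compat_l (C + 1)) in Hk; [|lra].
  replace ((C + 1) * (eps / (C + 1))) with eps in Hk by (field; lra). nra.
Qed.

Lemma derivable_lipschitz (g g' : R -> R) (M : R) : (forall t, derivable_pt_lim g t (g' t)) ->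
  (forall t, Rabs (g' t) <= M) -> forall s t, Rabs (g s - g t) <= M * Rabs (s - t).
Proof.
  intros Hd Hb s t. destruct (MVT_gen g t s g') as (c & _ & Hc).
  - intros x _. apply is_derive_Reals, Hd.
  - intros x _. apply derivable_continuous_pt. exists (g' x). apply Hd.
  - rewrite Hc, Rabs_mult. apply Rmult_le_compat_r; [apply Rabs_pos|apply Hb].
Qed.

(* Shear [n] is active for times between [tick n] and [tick (S n)]. The ratio [9/10] is chosen
   larger than [4/5], the rate at which the amplitudes of the shears will decay, so that the
   velocities still tend to [0]. *)
Definition tick (n : nat) : R := 1 - (9 / 10) ^ n.
Definition rate (n : nat) : R := 10 * (10 / 9) ^ n.
Definition step (n : nat) (t : R) : R := ramp (rate n * (t - tick n)).
Definition bump (n : nat) (t : R) : R := rate n * tent (rate n * (t - tick n)).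

Lemma rate_pos n : 0 < rate n.
Proof. unfold rate. pose proof (pow_lt (10 / 9) n ltac:(lra)). lra. Qed.

Lemma rate_tick n : rate n * (tick (S n) - tick n) = 1.
Proof.
  unfold rate, tick. simpl.
  replace (_ * _) with ((10 / 9) ^ n * (9 / 10) ^ n) by lra.
  rewrite <- Rpow_mult_distr. replace (10 / 9 * (9 / 10)) with 1 by field. apply pow1.
Qed.

Lemma tick_lt_1 n : tick n < 1.
Proof. unfold tick. pose proof (pow_lt (9 / 10) n ltac:(lra)). lra. Qed.

Lemma tick_0 : tick 0 = 0.
Proof. unfold tick. simpl. ring. Qed.

Lemma tick_mono m n : (m <= n)%nat -> tick m <= tick n.
Proof.
  induction 1 as [|n _ IH]; [lra|]. unfold tick in *. simpl.
  pose proof (pow_lt (9 / 10) n ltac:(lra)). lra.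
Qed.

Lemma tick_nonneg n : 0 <= tick n.
Proof. rewrite <- tick_0. apply tick_mono. lia. Qed.

Lemma tick_index t : 0 <= t < 1 -> exists N, tick N <= t <= tick (S N).
Proof.
  intros [H0 H1].
  destruct (pow_lt_1_zero (9 / 10) ltac:(rewrite Rabs_pos_eq; lra) (1 - t) ltac:(lra)) as [N HN].
  specialize (HN N (le_n N)). pose proof (Rle_abs ((9 / 10) ^ N)).
  assert (Ht : t <= tick N) by (unfold tick; lra). clear HN H.
  induction N as [|N IH].
  - exists O. rewrite tick_0 in *. pose proof (tick_nonneg 1). lra.
  - destruct (Rle_lt_dec t (tick N)) as [H|H]; [apply IH, H|].
    exists N. lra.
Qed.

Lemma bump_bound n t : 0 <= bump n t <= 2 * rate n.
Proof.
  unfold bump. pose proof (rate_pos n). pose proof (tent_bound (rate n * (t - tick n))). nra.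
Qed.

Lemma step_before n t : t <= tick n -> step n t = 0 /\ bump n t = 0.
Proof.
  intros H. pose proof (rate_pos n). assert (rate n * (t - tick n) <= 0) by nra.
  unfold step, bump. rewrite ramp_0, tent_outside by tauto. split; ring.
Qed.

Lemma step_after n t : tick (S n) <= t -> step n t = 1 /\ bump n t = 0.
Proof.
  intros H. pose proof (rate_pos n). pose proof (rate_tick n).
  assert (1 <= rate n * (t - tick n)) by nra.
  unfold step, bump. rewrite ramp_1, tent_outside by tauto. split; ring.
Qed.

Lemma step_derivable n t : derivable_pt_lim (step n) t (bump n t).
Proof.
  apply (derivable_of_taylor _ _ _ (8 * rate n ^ 2)).
  - pose proof (pow2_ge_0 (rate n)). lra.
  - intros k. unfold step, bump.
    pose proof (ramp_taylor (rate n * (t - tick n)) (rate n * k)) as H.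
    replace (rate n * (t - tick n) + rate n * k) with (rate n * (t + k - tick n)) in H by ring.
    replace (8 * rate n ^ 2 * k ^ 2) with (8 * (rate n * k) ^ 2) by ring.
    replace (k * (rate n * tent (rate n * (t - tick n))))
      with (rate n * k * tent (rate n * (t - tick n))) by ring. exact H.
Qed.

Lemma step_lipschitz n s t : Rabs (step n s - step n t) <= 2 * rate n * Rabs (s - t).
Proof.
  apply (derivable_lipschitz (step n) (bump n)); [apply step_derivable|].
  intros u. pose proof (bump_bound n u). rewrite Rabs_pos_eq; lra.
Qed.

Lemma bump_lipschitz n s t : Rabs (bump n s - bump n t) <= 16 * rate n ^ 2 * Rabs (s - t).
Proof.
  unfold bump. pose proof (rate_pos n).
  rewrite <- Rmult_minus_distr_l, Rabs_mult, (Rabs_pos_eq (rate n)) by lra.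
  pose proof (tent_lipschitz (rate n * (s - tick n)) (rate n * (t - tick n))) as H1.
  replace (rate n * (s - tick n) - rate n * (t - tick n)) with (rate n * (s - t)) in H1 by ring.
  rewrite Rabs_mult, (Rabs_pos_eq (rate n)) in H1 by lra.
  apply (Rmult_le_compat_l (rate n)) in H1; lra.
Qed.

Lemma bump_series t N c : tick N <= t <= tick (S N) ->
  Series (fun n => bump n t * c n) = bump N t * c N.
Proof.
  intros [H1 H2]. rewrite (Series_last _ N).
  - rewrite (psum_ext _ (fun _ => 0)), psum_zero; [ring|].
    intros n Hn. rewrite (proj2 (step_after n t (Rle_trans _ _ _ (tick_mono (S n) N Hn) H1))). ring.
  - intros n Hn. rewrite (proj2 (step_before n t (Rle_trans _ _ _ H2 (tick_mono (S N) n Hn)))). ring.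
Qed.

Lemma step_series t N c : tick N <= t <= tick (S N) ->
  Series (fun n => step n t * c n) = psum c N + step N t * c N.
Proof.
  intros [H1 H2]. rewrite (Series_last _ N).
  - f_equal. apply psum_ext.
    intros n Hn. rewrite (proj1 (step_after n t (Rle_trans _ _ _ (tick_mono (S n) N Hn) H1))). ring.
  - intros n Hn. rewrite (proj1 (step_before n t (Rle_trans _ _ _ H2 (tick_mono (S N) n Hn)))). ring.
Qed.

Lemma bump_1 n : bump n 1 = 0.
Proof. apply step_after. left. apply tick_lt_1. Qed.

Lemma step_1 n : step n 1 = 1.
Proof. apply step_after. left. apply tick_lt_1. Qed.

Lemma bump_series_1 c : Series (fun n => bump n 1 * c n) = 0.
Proof.
  rewrite (Series_ext _ (fun _ => 0)); [apply Series_zero|]. intros n. rewrite bump_1. ring.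
Qed.

(** * Shears are weakly divergence-free *)

Lemma box_integral_intro (F : pt -> R) (Rb v : R) (I : R -> R) :
  (forall x, is_RInt (fun y => F (x, y)) (- Rb) Rb (I x)) -> is_RInt I (- Rb) Rb v ->
  box_integral_is F Rb v.
Proof.
  intros Hin Hout.
  set (pr_in := fun x => ex_RInt_Reals_0 _ _ _ (ex_intro _ (I x) (Hin x))).
  assert (E : forall x, RiemannInt (pr_in x) = I x).
  { intros x. rewrite <- RInt_Reals. apply is_RInt_unique, Hin. }
  assert (Ho : is_RInt (fun x => RiemannInt (pr_in x)) (- Rb) Rb v).
  { apply (is_RInt_ext I); [|exact Hout]. intros x _. symmetry. apply E. }
  exists pr_in, (ex_RInt_Reals_0 _ _ _ (ex_intro _ v Ho)).
  rewrite <- RInt_Reals. apply is_RInt_unique, Ho.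
Qed.

Lemma continuous2_2d f x y : continuous2 f -> continuity_2d_pt (fun u v => f (u, v)) x y.
Proof.
  intros Hf eps. destruct (Hf (x, y) eps (cond_pos eps)) as (delta & Hd & H).
  assert (Hd2 : 0 < delta / 2) by lra. exists (mkposreal _ Hd2). simpl. intros u v Hu Hv.
  apply H. eapply Rle_lt_trans; [apply dist2_le_sum|]. simpl.
  rewrite (Rabs_minus_sym x), (Rabs_minus_sym y). lra.
Qed.

Lemma continuous2_section_y f x y : continuous2 f -> continuous (fun v => f (x, v)) y.
Proof.
  intros Hf. apply continuity_pt_filterlim. intros eps He.
  destruct (Hf (x, y) eps He) as (delta & Hd & H). exists delta. split; [exact Hd|].
  intros v [_ Hv]. apply H. eapply Rle_lt_trans; [apply dist2_le_sum|]. simpl.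
  rewrite Rminus_diag, Rabs_R0, Rabs_minus_sym, Rplus_0_l. exact Hv.
Qed.

Lemma lipschitz1_continuity f : lipschitz1 f -> continuity f.
Proof.
  intros (L & HL & Hf) x eps He. exists (eps / (L + 1)).
  assert (Hd : 0 < eps / (L + 1)) by (apply Rdiv_lt_0_compat; lra).
  split; [exact Hd|]. intros y [_ Hy]. simpl in *. unfold Rdist in *.
  eapply Rle_lt_trans; [apply Hf|].
  apply (Rmult_lt_compat_l (L + 1)) in Hy; [|lra].
  replace ((L + 1) * (eps / (L + 1))) with eps in Hy by (field; lra).
  pose proof (Rabs_pos (y - x)). lra.
Qed.

Lemma RInt_param_continuous (G : R -> R -> R) (a b x0 : R) : a < b ->
  (forall x y, continuity_2d_pt G x y) -> (forall x, ex_RInt (G x) a b) ->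
  continuous (fun x => RInt (G x) a b) x0.
Proof.
  intros Hab HG Hex. apply continuity_pt_filterlim. intros eps He.
  assert (He' : 0 < eps / (2 * (b - a))) by (apply Rdiv_lt_0_compat; lra).
  destruct (uniform_continuity_2d G (x0 - 1) (x0 + 1) a b (fun x y _ _ => HG x y)
              (mkposreal _ He')) as [delta Hd]. simpl in Hd.
  exists (Rmin delta 1). split; [apply Rmin_glb_lt; [apply cond_pos|lra]|].
  intros x [_ Hx]. simpl in *. unfold Rdist in *.
  assert (Hx1 : Rabs (x - x0) < delta) by (eapply Rlt_le_trans; [exact Hx|apply Rmin_l]).
  assert (Hx2 : Rabs (x - x0) < 1) by (eapply Rlt_le_trans; [exact Hx|apply Rmin_r]).
  apply Rabs_lt_between in Hx2.
  change (RInt (G x) a b - RInt (G x0) a b) with (minus (RInt (G x) a b) (RInt (G x0) a b)).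
  rewrite <- RInt_minus by apply Hex.
  eapply Rle_lt_trans.
  - apply (abs_RInt_le_const _ a b (eps / (2 * (b - a)))); [lra| |].
    + apply (ex_RInt_minus (V := R_NormedModule)); apply Hex.
    + intros y Hy. left. apply (Hd x0 y x y); try lra.
      rewrite Rminus_diag, Rabs_R0. apply cond_pos.
  - replace ((b - a) * (eps / (2 * (b - a)))) with (eps / 2) by (field; lra). lra.
Qed.

(** [supp_in_box] speaks only of points strictly outside the box; continuity carries the vanishing
    to its boundary, where the boundary terms of the integrations live. *)
Lemma supp_boundary (phi : pt -> R) (Rb : R) (p : pt) : continuous2 phi -> supp_in_box phi Rb ->
  Rabs (fst p) = Rb \/ Rabs (snd p) = Rb -> phi p = 0.
Proof.
  intros Hc Hs Hp. apply NNPP. intros Hne.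
  destruct (Hc p (Rabs (phi p)) (Rabs_pos_lt _ Hne)) as (delta & Hd & H).
  assert (Hout : exists q, dist2 p q < delta /\ (Rabs (fst q) > Rb \/ Rabs (snd q) > Rb)).
  { destruct p as [x y]. simpl in Hp.
    assert (Hmove : forall u, exists v, Rabs (u - v) <= delta / 2 /\ Rabs v > Rabs u).
    { intros u. destruct (Rle_lt_dec 0 u).
      - exists (u + delta / 2). split; unfold Rabs; repeat destruct Rcase_abs; lra.
      - exists (u - delta / 2). split; unfold Rabs; repeat destruct Rcase_abs; lra. }
    destruct Hp as [Hp|Hp].
    - destruct (Hmove x) as (v & Hv1 & Hv2). exists (v, y). split; [|left; simpl; lra].
      eapply Rle_lt_trans; [apply dist2_le_sum|]. simpl. rewrite Rminus_diag, Rabs_R0. lra.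
    - destruct (Hmove y) as (v & Hv1 & Hv2). exists (x, v). split; [|right; simpl; lra].
      eapply Rle_lt_trans; [apply dist2_le_sum|]. simpl. rewrite Rminus_diag, Rabs_R0. lra. }
  destruct Hout as (q & Hq & Ho). specialize (H q Hq). rewrite (Hs q Ho) in H.
  rewrite Rminus_0_l, Rabs_Ropp in H. lra.
Qed.

(** Uniqueness of derivatives identifies the given [g1] and [g2] with the continuous ones supplied
    by smoothness. *)
Lemma test_fun_C1 phi g1 g2 : test_fun phi -> (forall p, partial1 phi p (g1 p)) ->
  (forall p, partial2 phi p (g2 p)) -> continuous2 phi /\ continuous2 g1 /\ continuous2 g2.
Proof.
  intros [Hsm _] H1 H2. destruct (Hsm 1%nat) as (Hc & f1 & f2 & Hf1 & Hf2 & Hc1 & Hc2).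
  simpl in Hc1, Hc2. split; [exact Hc|].
  split; intros p eps He.
  - destruct (Hc1 p eps He) as (d & Hd & H). exists d. split; [exact Hd|]. intros q Hq.
    rewrite (uniqueness_limite _ _ _ _ (H1 q) (Hf1 q)), (uniqueness_limite _ _ _ _ (H1 p) (Hf1 p)).
    apply H, Hq.
  - destruct (Hc2 p eps He) as (d & Hd & H). exists d. split; [exact Hd|]. intros q Hq.
    rewrite (uniqueness_limite _ _ _ _ (H2 q) (Hf2 q)), (uniqueness_limite _ _ _ _ (H2 p) (Hf2 p)).
    apply H, Hq.
Qed.

(* The inner integration is along [y], so for a horizontal shear the derivative in [x] has to be
   taken out of the inner integral first. *)
Lemma shear_div_free (d : bool) (f : R -> R) (c : R) (phi g1 g2 : pt -> R) (Rb : R) :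
  lipschitz1 f -> test_fun phi -> (forall p, partial1 phi p (g1 p)) ->
  (forall p, partial2 phi p (g2 p)) -> Rb > 0 -> supp_in_box phi Rb ->
  box_integral_is (fun p => c * shear_x d f p * g1 p + c * shear_y d f p * g2 p) Rb 0.
Proof.
  intros Hf Ht H1 H2 HR Hs. destruct (test_fun_C1 phi g1 g2 Ht H1 H2) as (Hc & Hc1 & Hc2).
  pose proof (lipschitz1_continuity f Hf) as Hfc.
  assert (HRb : Rabs Rb = Rb) by (apply Rabs_pos_eq; lra).
  assert (HRb' : Rabs (- Rb) = Rb) by (rewrite Rabs_Ropp; exact HRb).
  destruct d; unfold shear_x, shear_y; simpl.
  - set (G := fun x y => c * f y * g1 (x, y)). set (H := fun x y => c * f y * phi (x, y)).
    assert (HG2 : forall x y, continuity_2d_pt G x y).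
    { intros x y. apply (continuity_2d_pt_mult (fun x y => c * f y) (fun x y => g1 (x, y))).
      - apply continuity_2d_pt_mult; [apply continuity_2d_pt_const|].
        apply (continuity_1d_2d_pt_comp f (fun _ y => y)); [apply Hfc|apply continuity_2d_pt_id2].
      - apply continuous2_2d, Hc1. }
    assert (Hcf : forall y, continuous (fun v => c * f v) y).
    { intros y. apply (continuous_scal_r c f), continuity_pt_filterlim, Hfc. }
    assert (HexG : forall x, ex_RInt (G x) (- Rb) Rb).
    { intros x. apply (ex_RInt_continuous (V := R_CompleteNormedModule)). intros y _.
      apply (continuous_mult (fun y => c * f y)); [apply Hcf|apply continuous2_section_y, Hc1]. }
    assert (HexH : forall x, ex_RInt (H x) (- Rb) Rb).
    { intros x. apply (ex_RInt_continuous (V := R_CompleteNormedModule)). intros y _.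
      apply (continuous_mult (fun y => c * f y)); [apply Hcf|apply continuous2_section_y, Hc]. }
    assert (HdH : forall x y, is_derive (fun u => H u y) x (G x y)).
    { intros x y. apply is_derive_Reals. unfold H, G.
      apply (derivable_pt_lim_scal (fun u => phi (u, y))). exact (H1 (x, y)). }
    assert (HDH : forall x y, Derive (fun u => H u y) x = G x y)
      by (intros; apply is_derive_unique, HdH).
    apply (box_integral_intro _ _ _ (fun x => RInt (G x) (- Rb) Rb)).
    + intros x. apply (is_RInt_ext (G x)); [|apply (RInt_correct (V := R_CompleteNormedModule)), HexG].
      intros y _. unfold G. simpl. ring.
    + assert (Hend : forall x, Rabs x = Rb -> RInt (H x) (- Rb) Rb = 0).
      { intros x Hx. rewrite (RInt_ext _ (fun _ => 0)).
        - rewrite RInt_const. apply Rmult_0_r.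
        - intros y _. change (c * f y * phi (x, y) = 0).
          rewrite (supp_boundary phi Rb (x, y) Hc Hs) by (left; exact Hx). ring. }
      (* Fundamental theorem of calculus in x for the inner integral of [H], which vanishes on both
         vertical sides of the box. *)
      replace 0 with (minus (RInt (H Rb) (- Rb) Rb) (RInt (H (- Rb)) (- Rb) Rb)).
      2:{ rewrite !Hend by assumption. apply Rminus_diag. }
      apply (is_RInt_derive (V := R_CompleteNormedModule) (fun x => RInt (H x) (- Rb) Rb)).
      * intros x _. rewrite (RInt_ext (G x) (fun y => Derive (fun u => H u y) x))
          by (intros; symmetry; apply HDH).
        apply (is_derive_RInt_param H).
        -- exists (mkposreal 1 Rlt_0_1). intros u _ y _. exists (G u y). apply HdH.
        -- intros y _. apply (continuity_2d_pt_ext G); [|apply HG2]. intros; symmetry; apply HDH.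
        -- exists (mkposreal 1 Rlt_0_1). intros u _. apply HexH.
      * intros x _. apply RInt_param_continuous; [lra|exact HG2|exact HexG].
  - apply (box_integral_intro _ _ _ (fun _ => 0)).
    + intros x. simpl.
      apply (is_RInt_ext (fun y => scal (c * f x) (g2 (x, y)))).
      { intros y _. change (c * f x * g2 (x, y) = c * 0 * g1 (x, y) + c * f x * g2 (x, y)). ring. }
      replace 0 with (scal (c * f x) (minus (phi (x, Rb)) (phi (x, - Rb)))).
      2:{ rewrite !(supp_boundary phi Rb) by (try assumption; right; assumption).
          change (c * f x * (0 - 0) = 0). ring. }
      apply (is_RInt_scal (V := R_NormedModule)).
      apply (is_RInt_derive (V := R_CompleteNormedModule) (fun y => phi (x, y))).
      * intros y _. apply is_derive_Reals. exact (H2 (x, y)).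
      * intros y _. apply continuous2_section_y, Hc2.
    + pose proof (is_RInt_const (V := R_NormedModule) (- Rb) Rb 0) as Hk.
      rewrite (Rmult_0_r (Rb - - Rb) : scal (Rb - - Rb) (0 : R_NormedModule) = 0) in Hk. exact Hk.
Qed.

(** * Flows made of successive shears *)

(** Composition with [clamp] extends a curve controlled only on [0,1] by constants, so that
    two-sided notions of continuity apply at the end points. *)
Definition clamp (t : R) : R := Rmax 0 (Rmin 1 t).

Lemma clamp_id t : 0 <= t <= 1 -> clamp t = t.
Proof. intros H. unfold clamp, Rmin. destruct Rle_dec; unfold Rmax; destruct Rle_dec; lra. Qed.

Lemma clamp_range t : 0 <= clamp t <= 1.
Proof. unfold clamp, Rmin. destruct Rle_dec; unfold Rmax; destruct Rle_dec; lra. Qed.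

Lemma clamp_lipschitz s t : Rabs (clamp s - clamp t) <= Rabs (s - t).
Proof.
  unfold clamp. eapply Rle_trans; [apply Rmax_lipschitz|]. apply Rmin_lipschitz.
Qed.

Definition deriv01 (u : R -> R) (t l : R) : Prop :=
  forall eps, eps > 0 -> exists delta, delta > 0 /\
    forall k, k <> 0 -> 0 <= t + k <= 1 -> Rabs k < delta -> Rabs ((u (t + k) - u t) / k - l) < eps.

Lemma solves_ode_deriv01 U gamma t : solves_ode U gamma -> 0 <= t <= 1 ->
  deriv01 (fun s => fst (gamma s)) t (fst (U t (gamma t))) /\
  deriv01 (fun s => snd (gamma s)) t (snd (U t (gamma t))).
Proof.
  intros H Ht. split; intros eps He; destruct (H t Ht eps He) as (delta & Hd & Hk);
    exists delta; (split; [exact Hd|]); intros k H1 H2 H3; apply (Hk k H1 H2 H3).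
Qed.

Lemma deriv01_continuity u t l : 0 <= t <= 1 -> deriv01 u t l ->
  continuity_pt (fun s => u (clamp s)) t.
Proof.
  intros Ht Hu eps He. destruct (Hu 1 Rlt_0_1) as (delta & Hd & H).
  assert (He' : 0 < eps / (Rabs l + 1))
    by (apply Rdiv_lt_0_compat; [lra|pose proof (Rabs_pos l); lra]).
  exists (Rmin delta (eps / (Rabs l + 1))). split; [apply Rmin_glb_lt; assumption|].
  intros s [_ Hs]. simpl in *. unfold Rdist in *. rewrite (clamp_id t Ht).
  set (k := clamp s - t).
  assert (Hk : Rabs k <= Rabs (s - t))
    by (unfold k; rewrite <- (clamp_id t Ht) at 1; apply clamp_lipschitz).
  pose proof (clamp_range s).
  replace (clamp s) with (t + k) by (unfold k; ring).
  destruct (Req_dec k 0) as [Hk0|Hk0].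
  - rewrite Hk0, Rplus_0_r, Rminus_diag, Rabs_R0. exact He.
  - pose proof (Rmin_l delta (eps / (Rabs l + 1))). pose proof (Rmin_r delta (eps / (Rabs l + 1))).
    specialize (H k Hk0 ltac:(unfold k; lra) ltac:(lra)).
    replace (u (t + k) - u t) with (k * ((u (t + k) - u t) / k - l) + k * l) by (field; exact Hk0).
    eapply Rle_lt_trans; [apply Rabs_triang|]. rewrite !Rabs_mult.
    pose proof (Rabs_pos_lt k Hk0). pose proof (Rabs_pos l).
    assert (Hke : Rabs k < eps / (Rabs l + 1)) by lra.
    apply (Rmult_lt_compat_l (Rabs l + 1)) in Hke; [|lra].
    replace ((Rabs l + 1) * (eps / (Rabs l + 1))) with eps in Hke by (field; lra). nra.
Qed.

Lemma deriv01_interior u t l : 0 < t < 1 -> deriv01 u t l ->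
  derivable_pt_lim (fun s => u (clamp s)) t l.
Proof.
  intros Ht Hu eps He. destruct (Hu eps He) as (delta & Hd & H).
  assert (Hm : 0 < Rmin delta (Rmin t (1 - t))) by (repeat apply Rmin_glb_lt; lra).
  exists (mkposreal _ Hm). intros k Hk0 Hk. simpl in Hk.
  pose proof (Rmin_l delta (Rmin t (1 - t))). pose proof (Rmin_r delta (Rmin t (1 - t))).
  pose proof (Rmin_l t (1 - t)). pose proof (Rmin_r t (1 - t)).
  assert (Htk : 0 <= t + k <= 1).
  { assert (Hb : Rabs k < t) by lra. assert (Hb' : Rabs k < 1 - t) by lra.
    apply Rabs_lt_between in Hb, Hb'. lra. }
  rewrite !clamp_id by lra. apply H; [exact Hk0|exact Htk|lra].
Qed.

(** Mean value theorem for u - c G: its derivative vanishes inside [a,b], and at the ends continuity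
    of the clamped curve is enough. *)
Lemma deriv01_proportional (u v G G' : R -> R) (c a b : R) : 0 <= a <= b -> b <= 1 ->
  (forall t, 0 <= t <= 1 -> deriv01 u t (v t)) -> (forall t, derivable_pt_lim G t (G' t)) ->
  (forall t, a <= t <= b -> v t = c * G' t) -> u b - u a = c * (G b - G a).
Proof.
  intros Hab Hb1 Hu HG Hv.
  destruct (MVT_gen (fun s => u (clamp s) - c * G s) a b (fun _ => 0)) as (x & _ & Hx).
  - rewrite Rmin_left, Rmax_right by lra. intros t Ht. apply is_derive_Reals.
    replace 0 with (v t - c * G' t) by (rewrite Hv by lra; ring).
    apply (derivable_pt_lim_minus (fun s => u (clamp s)) (fun s => c * G s)).
    + apply deriv01_interior; [lra|]. apply Hu. lra.
    + apply derivable_pt_lim_scal, HG.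
  - rewrite Rmin_left, Rmax_right by lra. intros t Ht.
    apply (continuity_pt_minus (fun s => u (clamp s)) (fun s => c * G s)).
    + apply (deriv01_continuity u t (v t)); [lra|]. apply Hu. lra.
    + apply (continuity_pt_scal G). apply derivable_continuous_pt. exists (G' t). apply HG.
  - rewrite !clamp_id in Hx by lra. lra.
Qed.

Lemma deriv01_endpoint u w l m : deriv01 u 1 l -> deriv01 w 1 m ->
  (forall t, 0 <= t < 1 -> u t = w t) -> u 1 = w 1.
Proof.
  intros Hu Hw H. apply NNPP. intros Hne.
  assert (Hc : continuity_pt (fun s => u (clamp s) - w (clamp s)) 1).
  { apply (continuity_pt_minus (fun s => u (clamp s)) (fun s => w (clamp s)));
      eapply deriv01_continuity; try eassumption; lra. }
  assert (Hp : 0 < Rabs (u 1 - w 1)) by (apply Rabs_pos_lt; lra).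
  destruct (Hc _ Hp) as (delta & Hd & Hk).
  set (s := 1 - Rmin (delta / 2) (/ 2)).
  assert (Hm : 0 < Rmin (delta / 2) (/ 2)) by (apply Rmin_glb_lt; lra).
  pose proof (Rmin_l (delta / 2) (/ 2)). pose proof (Rmin_r (delta / 2) (/ 2)).
  assert (Hs : Rabs ((u (clamp s) - w (clamp s)) - (u (clamp 1) - w (clamp 1))) < Rabs (u 1 - w 1)).
  { apply Hk. split; [split; [exact I|unfold s; lra]|]. simpl. unfold Rdist, s.
    rewrite Rabs_left; lra. }
  rewrite !clamp_id in Hs by (unfold s; lra). rewrite (H s) in Hs by (unfold s; lra).
  rewrite Rminus_diag, Rminus_0_l, Rabs_Ropp in Hs. lra.
Qed.

(** * The velocity field of successive shears, its flow and uniqueness *)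

Section ShearFlow.

Variable dir : nat -> bool.
Variable f : nat -> R -> R.
Hypothesis f_lip : forall n, lipschitz1 (f n).
Hypothesis f_bound : forall n x, Rabs (f n x) <= 2 * (4 / 5) ^ n.

Let fx (n : nat) : pt -> R := shear_x (dir n) (f n).
Let fy (n : nat) : pt -> R := shear_y (dir n) (f n).

Definition field (t : R) (p : pt) : pt :=
  (Series (fun n => bump n t * fx n p), Series (fun n => bump n t * fy n p)).

Fixpoint stage (n : nat) (a : pt) : pt :=
  match n with O => a | S m => shear (dir m) (f m) 1 (stage m a) end.

(** Each profile is evaluated where its shear starts, at [stage n a], since it keeps this value
    while the shear acts. This makes the flow an explicit series, defined at time 1 as well. *)
Definition flow (t : R) (a : pt) : pt :=
  (fst a + Series (fun n => step n t * fx n (stage n a)),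
   snd a + Series (fun n => step n t * fy n (stage n a))).

Let fxy_bound n p : Rabs (fx n p) <= 2 * (4 / 5) ^ n /\ Rabs (fy n p) <= 2 * (4 / 5) ^ n.
Proof.
  pose proof (pow_lt (4 / 5) n ltac:(lra)).
  unfold fx, fy, shear_x, shear_y. destruct (dir n); rewrite Rabs_R0; split; auto; lra.
Qed.

Let fxy_lipschitz n : exists L, 0 <= L /\ forall p q,
  Rabs (fx n p - fx n q) <= L * dist2 p q /\ Rabs (fy n p - fy n q) <= L * dist2 p q.
Proof.
  destruct (f_lip n) as (L & HL & Hf). exists L. split; [exact HL|]. intros p q.
  assert (H0 : Rabs (0 - 0) <= L * dist2 p q).
  { rewrite Rminus_diag, Rabs_R0. apply Rmult_le_pos; [exact HL|apply dist2_pos]. }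
  pose proof (Rmult_le_compat_l L _ _ HL (dist2_fst p q)).
  pose proof (Rmult_le_compat_l L _ _ HL (dist2_snd p q)).
  unfold fx, fy, shear_x, shear_y. destruct (dir n); split; try exact H0.
  - eapply Rle_trans; [apply Hf|assumption].
  - eapply Rle_trans; [apply Hf|assumption].
Qed.

(** Bound for the n-th velocity: acceleration by 10/9 against amplitude decay 4/5 leaves the
    summable ratio 8/9. *)
Let vel (n : nat) : R := 40 * (8 / 9) ^ n.

Let ex_vel : ex_series vel.
Proof.
  apply (ex_series_scal (V := R_NormedModule) 40 (fun n => (8 / 9) ^ n)), ex_series_geom.
  rewrite Rabs_pos_eq; lra.
Qed.

Let vel_eq n : 2 * rate n * (2 * (4 / 5) ^ n) = vel n.
Proof.
  unfold vel, rate. replace (8 / 9) with (10 / 9 * (4 / 5)) by field.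
  rewrite Rpow_mult_distr. ring.
Qed.

Let ex_amplitude : ex_series (fun n => 2 * (4 / 5) ^ n).
Proof.
  apply (ex_series_scal (V := R_NormedModule) 2 (fun n => (4 / 5) ^ n)), ex_series_geom.
  rewrite Rabs_pos_eq; lra.
Qed.

Let bump_c_bound n t c : Rabs c <= 2 * (4 / 5) ^ n -> Rabs (bump n t * c) <= vel n.
Proof.
  intros Hc. rewrite <- vel_eq, Rabs_mult. pose proof (bump_bound n t).
  apply Rmult_le_compat; try apply Rabs_pos; [rewrite Rabs_pos_eq; lra|exact Hc].
Qed.

Let bump_c_ucont (w : nat -> pt -> R) : (forall n p, Rabs (w n p) <= 2 * (4 / 5) ^ n) ->
  (forall n, exists L, 0 <= L /\ forall p q, Rabs (w n p - w n q) <= L * dist2 p q) ->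
  ucont (fun t p => Series (fun n => bump n t * w n p)).
Proof.
  intros Hb Hl. apply (ucont_series (fun n t p => bump n t * w n p) vel ex_vel).
  - intros n. destruct (Hl n) as (L & HL & Hw).
    pose proof (rate_pos n). pose proof (pow_lt (4 / 5) n ltac:(lra)).
    set (A := 16 * rate n ^ 2 * (2 * (4 / 5) ^ n)). set (B := 2 * rate n * L).
    assert (HA : 0 <= A) by (unfold A; pose proof (pow2_ge_0 (rate n)); nra).
    assert (HB : 0 <= B) by (unfold B; nra).
    apply (ucont_lipschitz _ (A + B)); [lra|]. intros t s x y.
    replace (bump n t * w n x - bump n s * w n y)
      with ((bump n t - bump n s) * w n y + bump n t * (w n x - w n y)) by ring.
    eapply Rle_trans; [apply Rabs_triang|]. rewrite !Rabs_mult.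
    assert (H1 : Rabs (bump n t - bump n s) * Rabs (w n y) <= A * Rabs (t - s)).
    { unfold A. replace (16 * rate n ^ 2 * (2 * (4 / 5) ^ n) * Rabs (t - s))
        with ((16 * rate n ^ 2 * Rabs (t - s)) * (2 * (4 / 5) ^ n)) by ring.
      apply Rmult_le_compat; try apply Rabs_pos; [apply bump_lipschitz|apply Hb]. }
    assert (H2 : Rabs (bump n t) * Rabs (w n x - w n y) <= B * dist2 x y).
    { unfold B. rewrite Rmult_assoc. pose proof (bump_bound n t).
      apply Rmult_le_compat; try apply Rabs_pos; [rewrite Rabs_pos_eq; lra|apply Hw]. }
    pose proof (Rabs_pos (t - s)). pose proof (dist2_pos x y). nra.
  - intros n t p. apply bump_c_bound, Hb.
Qed.

Lemma field_unif_cont : unif_cont field.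
Proof.
  intros eps He.
  destruct (bump_c_ucont fx (fun n p => proj1 (fxy_bound n p))) with (eps := eps / 2)
    as (d1 & Hd1 & H1); [|lra|].
  { intros n. destruct (fxy_lipschitz n) as (L & HL & H). exists L. split; [exact HL|]. apply H. }
  destruct (bump_c_ucont fy (fun n p => proj2 (fxy_bound n p))) with (eps := eps / 2)
    as (d2 & Hd2 & H2); [|lra|].
  { intros n. destruct (fxy_lipschitz n) as (L & HL & H). exists L. split; [exact HL|]. apply H. }
  exists (Rmin d1 d2). split; [apply Rmin_glb_lt; assumption|].
  intros t s x y Ht Hs Hts Hxy. eapply Rle_lt_trans; [apply dist2_le_sum|]. simpl.
  pose proof (Rmin_l d1 d2). pose proof (Rmin_r d1 d2).
  specialize (H1 t s x y Ht Hs ltac:(lra) ltac:(lra)).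
  specialize (H2 t s x y Ht Hs ltac:(lra) ltac:(lra)). lra.
Qed.

Lemma field_on_interval t N p : tick N <= t <= tick (S N) ->
  field t p = (bump N t * fx N p, bump N t * fy N p).
Proof. intros Ht. unfold field. rewrite !(bump_series t N) by exact Ht. reflexivity. Qed.

Lemma field_final p : field 1 p = (0, 0).
Proof. unfold field. rewrite !bump_series_1. reflexivity. Qed.

(** At a fixed time the field is a multiple of a single shear field; at time 1 it is the multiple
    0. *)
Lemma field_div_free : weakly_div_free field.
Proof.
  intros t Ht phi g1 g2 Htest H1 H2 Rb HR Hs.
  assert (Hf : exists N c, forall p, field t p = (c * fx N p, c * fy N p)).
  { destruct (Rle_lt_or_eq_dec t 1 (proj2 Ht)) as [Hlt| ->].
    - destruct (tick_index t ltac:(lra)) as [N HN]. exists N, (bump N t). intros p.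
      apply field_on_interval, HN.
    - exists O, 0. intros p. rewrite field_final. f_equal; ring. }
  destruct Hf as (N & c & Hf).
  destruct (shear_div_free (dir N) (f N) c phi g1 g2 Rb (f_lip N) Htest H1 H2 HR Hs)
    as (pr_in & pr_out & Hv).
  apply (box_integral_intro _ _ _ (fun x => RiemannInt (pr_in x))).
  - intros x. apply (is_RInt_ext (fun y => c * shear_x (dir N) (f N) (x, y) * g1 (x, y)
                                         + c * shear_y (dir N) (f N) (x, y) * g2 (x, y))).
    + intros y _. rewrite Hf. reflexivity.
    + rewrite <- RInt_Reals. apply (RInt_correct (V := R_CompleteNormedModule)).
      apply ex_RInt_Reals_1, pr_in.
  - rewrite <- Hv, <- RInt_Reals. apply (RInt_correct (V := R_CompleteNormedModule)).
    apply ex_RInt_Reals_1, pr_out.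
Qed.

Lemma stage_psum n a :
  stage n a = (fst a + psum (fun m => fx m (stage m a)) n,
               snd a + psum (fun m => fy m (stage m a)) n).
Proof.
  induction n as [|n IH]; simpl.
  - rewrite !Rplus_0_r. destruct a; reflexivity.
  - rewrite IH at 1. unfold shear; simpl. fold (fx n) (fy n). rewrite <- IH.
    f_equal; ring.
Qed.

Lemma flow_on_interval t N a : tick N <= t <= tick (S N) ->
  flow t a = shear (dir N) (f N) (step N t) (stage N a).
Proof.
  intros Ht. unfold flow. rewrite !(step_series t N) by exact Ht.
  unfold shear. fold (fx N) (fy N). rewrite (stage_psum N a) at 3 5. simpl. f_equal; ring.
Qed.

Lemma flow_0 a : flow 0 a = a.
Proof.
  rewrite (flow_on_interval 0 0); [|rewrite tick_0; pose proof (tick_nonneg 1); lra].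
  rewrite (proj1 (step_before 0 0 ltac:(rewrite tick_0; lra))).
  destruct a as [x y]. unfold shear; simpl. f_equal; ring.
Qed.

Let step_series_derivable (c : nat -> R) t : (forall n, Rabs (c n) <= 2 * (4 / 5) ^ n) ->
  derivable_pt_lim (fun s => Series (fun n => step n s * c n)) t (Series (fun n => bump n t * c n)).
Proof.
  intros Hc.
  apply (series_derivable (fun n s => step n s * c n) (fun n s => bump n s * c n) vel ex_vel).
  - intros n s. pose proof (derivable_pt_lim_scal (step n) (c n) s _ (step_derivable n s)) as H.
    rewrite Rmult_comm in H.
    intros eps He. destruct (H eps He) as [d Hd]. exists d. intros k Hk0 Hk.
    specialize (Hd k Hk0 Hk). unfold mult_real_fct in Hd.
    rewrite !(Rmult_comm (step n _)). exact Hd.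
  - intros n s u. rewrite <- Rmult_minus_distr_r, Rabs_mult, <- vel_eq.
    replace (2 * rate n * (2 * (4 / 5) ^ n) * Rabs (s - u))
      with ((2 * rate n * Rabs (s - u)) * (2 * (4 / 5) ^ n)) by ring.
    apply Rmult_le_compat; try apply Rabs_pos; [apply step_lipschitz|apply Hc].
  - intros n s. apply bump_c_bound, Hc.
  - intros s. apply (ex_series_dominated _ (fun n => 2 * (4 / 5) ^ n)); [|exact ex_amplitude].
    intros n. rewrite Rabs_mult. specialize (Hc n).
    pose proof (ramp_bound (rate n * (s - tick n))). unfold step.
    pose proof (Rabs_pos (c n)). pose proof (Rabs_pos (ramp (rate n * (s - tick n)))). nra.
Qed.

(** The velocity met by the moving point is the one at the start of the current shear, by
    [shear_field_invariant]; so it is the termwise derivative of [flow]. *)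
Lemma field_along_flow t a : 0 <= t <= 1 ->
  field t (flow t a) = (Series (fun n => bump n t * fx n (stage n a)),
                        Series (fun n => bump n t * fy n (stage n a))).
Proof.
  intros Ht. destruct (Rle_lt_or_eq_dec t 1 (proj2 Ht)) as [Hlt| ->].
  - destruct (tick_index t ltac:(lra)) as [N HN].
    rewrite (field_on_interval t N) by exact HN. rewrite !(bump_series t N) by exact HN.
    rewrite (flow_on_interval t N) by exact HN. unfold fx, fy.
    destruct (shear_field_invariant (dir N) (f N) (step N t) (stage N a)) as [-> ->]. reflexivity.
  - rewrite field_final, !bump_series_1. reflexivity.
Qed.

(** Termwise differentiation is valid at every real time, so time 1 is covered together with the
    others. *)
Lemma flow_trajectory : trajectory_map field flow.
Proof.
  intros a. split; [|apply flow_0]. intros t Ht eps He.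
  rewrite (field_along_flow t a Ht).
  destruct (step_series_derivable (fun n => fx n (stage n a)) t
              (fun n => proj1 (fxy_bound n _)) eps He) as [d1 H1].
  destruct (step_series_derivable (fun n => fy n (stage n a)) t
              (fun n => proj2 (fxy_bound n _)) eps He) as [d2 H2].
  exists (Rmin d1 d2). split; [apply Rmin_glb_lt; apply cond_pos|].
  intros k Hk0 _ Hk. pose proof (Rmin_l d1 d2). pose proof (Rmin_r d1 d2).
  specialize (H1 k Hk0 ltac:(lra)). specialize (H2 k Hk0 ltac:(lra)).
  unfold flow; simpl fst; simpl snd. split.
  - match goal with |- Rabs ((?x + ?u - (?x + ?v)) / k - ?l) < eps =>
      replace (x + u - (x + v)) with (u - v) by ring end. exact H1.
  - match goal with |- Rabs ((?x + ?u - (?x + ?v)) / k - ?l) < eps =>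
      replace (x + u - (x + v)) with (u - v) by ring end. exact H2.
Qed.

(* While a shear acts, it does not change the coordinate on which its velocity depends, so the
   equation can be integrated explicitly; no Gronwall argument is needed. *)
Lemma solution_on_interval gamma t N : solves_ode field gamma -> tick N <= t <= tick (S N) ->
  gamma t = shear (dir N) (f N) (step N t) (gamma (tick N)).
Proof.
  intros Hg Ht. pose proof (tick_nonneg N). pose proof (tick_lt_1 (S N)).
  assert (Hx := fun s Hs => proj1 (solves_ode_deriv01 field gamma s Hg Hs)).
  assert (Hy := fun s Hs => proj2 (solves_ode_deriv01 field gamma s Hg Hs)).
  assert (Hs0 : step N (tick N) = 0) by (apply step_before; lra).
  (* [Hconst] is for the coordinate at rest, which the profile reads; [Hmove] for the other one,
     whose velocity is then a constant times [bump N]. *)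
  assert (Hconst : forall u v s, tick N <= s <= tick (S N) ->
            (forall r, 0 <= r <= 1 -> deriv01 u r (v r)) ->
            (forall r, tick N <= r <= s -> v r = 0) -> u s = u (tick N)).
  { intros u v s Hs Hu Hv.
    pose proof (deriv01_proportional u v (step N) (bump N) 0 (tick N) s ltac:(lra) ltac:(lra) Hu
                  (step_derivable N)) as E.
    assert (u s - u (tick N) = 0 * (step N s - step N (tick N))); [|lra].
    apply E. intros r Hr. rewrite Hv by exact Hr. ring. }
  assert (Hmove : forall u v c, (forall r, 0 <= r <= 1 -> deriv01 u r (v r)) ->
            (forall r, tick N <= r <= t -> v r = c * bump N r) -> u t = u (tick N) + step N t * c).
  { intros u v c Hu Hv.
    pose proof (deriv01_proportional u v (step N) (bump N) c (tick N) t ltac:(lra) ltac:(lra) Hu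
                  (step_derivable N) Hv) as E. rewrite Hs0 in E. lra. }
  assert (Hfield : forall r, tick N <= r <= t ->
            field r (gamma r) = (bump N r * fx N (gamma r), bump N r * fy N (gamma r))).
  { intros r Hr. apply field_on_interval. lra. }
  apply injective_projections.
  - unfold shear; simpl fst. unfold shear_x. destruct (dir N) eqn:Ed.
    + apply (Hmove _ _ _ Hx). intros r Hr. rewrite Hfield by exact Hr. simpl.
      unfold fx, shear_x. rewrite Ed, Rmult_comm. f_equal. f_equal.
      apply (Hconst (fun s => snd (gamma s)) _ r ltac:(lra) Hy). intros q Hq.
      rewrite Hfield by lra. simpl. unfold fy, shear_y. rewrite Ed. ring.
    + rewrite Rmult_0_r, Rplus_0_r. apply (Hconst (fun s => fst (gamma s)) _ t Ht Hx). intros q Hq.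
      rewrite Hfield by lra. simpl. unfold fx, shear_x. rewrite Ed. ring.
  - unfold shear; simpl snd. unfold shear_y. destruct (dir N) eqn:Ed.
    + rewrite Rmult_0_r, Rplus_0_r. apply (Hconst (fun s => snd (gamma s)) _ t Ht Hy). intros q Hq.
      rewrite Hfield by lra. simpl. unfold fy, shear_y. rewrite Ed. ring.
    + apply (Hmove _ _ _ Hy). intros r Hr. rewrite Hfield by exact Hr. simpl.
      unfold fy, shear_y. rewrite Ed, Rmult_comm. f_equal. f_equal.
      apply (Hconst (fun s => fst (gamma s)) _ r ltac:(lra) Hx). intros q Hq.
      rewrite Hfield by lra. simpl. unfold fx, shear_x. rewrite Ed. ring.
Qed.

Lemma solution_at_tick gamma N : solves_ode field gamma -> gamma (tick N) = stage N (gamma 0).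
Proof.
  intros Hg. induction N as [|N IH]; [rewrite tick_0; reflexivity|].
  pose proof (tick_mono N (S N) ltac:(lia)).
  rewrite (solution_on_interval gamma (tick (S N)) N Hg) by lra.
  rewrite (proj1 (step_after N (tick (S N)) ltac:(lra))), IH. reflexivity.
Qed.

(** A time before 1 is reached after finitely many shears; at time 1 both curves are continuous and
    agree to the left. *)
Lemma solution_is_flow gamma t : solves_ode field gamma -> 0 <= t <= 1 ->
  gamma t = flow t (gamma 0).
Proof.
  intros Hg Ht.
  assert (Hlt : forall s, 0 <= s < 1 -> gamma s = flow s (gamma 0)).
  { intros s Hs. destruct (tick_index s Hs) as [N HN].
    rewrite (solution_on_interval gamma s N Hg HN), (flow_on_interval s N _ HN).
    rewrite (solution_at_tick gamma N Hg). reflexivity. }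
  destruct (Rle_lt_or_eq_dec t 1 (proj2 Ht)) as [Hl| ->]; [apply Hlt; lra|].
  destruct (solves_ode_deriv01 field gamma 1 Hg Ht) as [G1 G2].
  destruct (solves_ode_deriv01 field _ 1 (proj1 (flow_trajectory (gamma 0))) Ht) as [F1 F2].
  apply injective_projections.
  - apply (deriv01_endpoint _ _ _ _ G1 F1). intros s Hs. rewrite (Hlt s Hs). reflexivity.
  - apply (deriv01_endpoint _ _ _ _ G2 F2). intros s Hs. rewrite (Hlt s Hs). reflexivity.
Qed.

Lemma field_unique : unique_trajectories field.
Proof.
  intros g1 g2 H1 H2 H0 t Ht.
  rewrite (solution_is_flow g1 t H1 Ht), (solution_is_flow g2 t H2 Ht), H0. reflexivity.
Qed.

Lemma bilipschitz_stage n : bilipschitz (stage n).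
Proof.
  induction n as [|n IH].
  - exists 1. split; [lra|]. intros p q. simpl. lra.
  - apply (bilipschitz_comp (stage n) (shear (dir n) (f n) 1) IH), shear_bilipschitz, f_lip.
Qed.

(** Only finitely many shears have started by a time below 1; the constant depends on how many. *)
Lemma bilipschitz_flow t : 0 <= t < 1 -> bilipschitz (flow t).
Proof.
  intros Ht. destruct (tick_index t Ht) as [N HN].
  destruct (bilipschitz_comp _ _ (bilipschitz_stage N)
              (shear_bilipschitz (dir N) (f N) (step N t) (f_lip N))) as (L & HL & H).
  exists L. split; [exact HL|]. intros p q. rewrite !(flow_on_interval t N) by exact HN. apply H.
Qed.

(** The series converges, so it suffices that the partial sums of [3 * k] terms, taken after whole
    blocks, tend to -x. *)
Let flow_final_limit (c : nat -> R) (x : R) : (forall n, Rabs (c n) <= 2 * (4 / 5) ^ n) ->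
  (forall k, Rabs (x + psum c (3 * k)) <= (/ 2) ^ k) -> x + Series (fun n => step n 1 * c n) = 0.
Proof.
  intros Hc Hk. rewrite (Series_ext _ c) by (intros n; rewrite step_1; ring).
  apply NNPP. intros Hne. pose proof (Rabs_pos_lt _ Hne) as Hp.
  set (eps := Rabs (x + Series c)) in *.
  destruct (series_tail_small c (eps / 2) (ex_series_dominated _ _ Hc ex_amplitude)) as [N HN];
    [lra|].
  destruct (half_pow_small (eps / 2)) as [k Hk']; [lra|].
  (* Positive, so that [3 * m] terms are a [sum_f_R0] up to index [3 * m - 1], and that index is at
     least [N]. *)
  set (m := S (N + k)). specialize (Hk m).
  assert (Hm : (/ 2) ^ m <= (/ 2) ^ k) by (apply half_pow_le; unfold m; lia).
  replace (3 * m)%nat with (S (3 * m - 1)) in Hk by (unfold m; lia).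
  rewrite psum_S in Hk. specialize (HN (3 * m - 1)%nat ltac:(unfold m; lia)).
  pose proof (Rabs_triang (x + sum_f_R0 c (3 * m - 1)) (Series c - sum_f_R0 c (3 * m - 1))) as Ht.
  replace (_ + _ + (_ - _)) with (x + Series c) in Ht by ring. fold eps in Ht. lra.
Qed.

Lemma flow_final a :
  (forall k, Rabs (fst (stage (3 * k) a)) <= (/ 2) ^ k /\
             Rabs (snd (stage (3 * k) a)) <= (/ 2) ^ k) -> flow 1 a = (0, 0).
Proof.
  intros H. unfold flow. f_equal; apply flow_final_limit.
  - intros n. apply fxy_bound.
  - intros k. destruct (H k) as [Hk _]. rewrite stage_psum in Hk. exact Hk.
  - intros n. apply fxy_bound.
  - intros k. destruct (H k) as [_ Hk]. rewrite stage_psum in Hk. exact Hk.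
Qed.

End ShearFlow.

(** * Iterating the emptying of slots, and conclusion *)

(** [empty_slot] is iterated, the slot set left by one block being the input of the next. After [k]
    blocks the used slots start at [k], which bounds both coordinates by 2^-k. *)
Lemma shear_sequence (A0 : nat -> Prop) : coinfinite A0 ->
  exists (dir : nat -> bool) (f : nat -> R -> R),
    (forall n, lipschitz1 (f n)) /\ (forall n x, Rabs (f n x) <= 2 * (4 / 5) ^ n) /\
    forall k p, cantor2 A0 p ->
      Rabs (fst (stage dir f (3 * k) p)) <= (/ 2) ^ k /\
      Rabs (snd (stage dir f (3 * k) p)) <= (/ 2) ^ k.
Proof.
  intros HA0.
  set (ok := fun k (A : nat -> Prop) => coinfinite A /\ forall l, (l < k)%nat -> ~ A l).
  set (good := fun k (A A' : nat -> Prop) (g : nat -> R -> R) =>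
    ok (S k) A' /\ (forall i, lipschitz1 (g i)) /\ (forall i x, Rabs (g i x) <= (/ 2) ^ k) /\
    forall p, cantor2 A p ->
      cantor2 A' (shear false (g 2%nat) 1 (shear true (g 1%nat) 1 (shear false (g O) 1 p)))).
  assert (Hstep : forall kA : nat * (nat -> Prop), exists r : (nat -> Prop) * (nat -> R -> R),
            ok (fst kA) (snd kA) -> good (fst kA) (snd kA) (fst r) (snd r)).
  { intros [k A]. simpl. destruct (classic (ok k A)) as [[H1 H2]|Hn].
    - destruct (empty_slot A k H1 H2) as (A' & f0 & f1 & f2 & Hok & (L0 & L1 & L2) & Hb & Hmap).
      exists (A', fun i => match i with O => f0 | 1%nat => f1 | _ => f2 end). intros _.
      split; [exact Hok|]. split; [intros [|[|i]]; assumption|].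
      split; [intros [|[|i]] x; apply Hb|exact Hmap].
    (* A default that makes the choice total; by [Hok] the recursion only meets admissible pairs. *)
    - exists (A, fun _ x => x). tauto. }
  apply functional_choice in Hstep. destruct Hstep as [nxt Hnxt].
  set (A := fix A k := match k with O => A0 | S m => fst (nxt (m, A m)) end).
  assert (Hok : forall k, ok k (A k)).
  { induction k as [|k IH]; [split; [exact HA0|intros; lia]|]. apply (Hnxt (k, A k) IH). }
  assert (Hgood : forall k, good k (A k) (A (S k)) (snd (nxt (k, A k))))
    by (intros k; apply (Hnxt (k, A k)), Hok).
  (* Shear [n] is number [n mod 3] of block [n / 3]; the middle one of each block is horizontal. *)
  set (dir := fun n => Nat.eqb (n mod 3) 1).
  set (f := fun n => snd (nxt ((n / 3)%nat, A (n / 3)%nat)) (n mod 3)%nat).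
  exists dir, f. split; [|split].
  - intros n. apply (Hgood (n / 3)%nat).
  - intros n x. destruct (Hgood (n / 3)%nat) as (_ & _ & Hb & _).
    eapply Rle_trans; [apply Hb|].
    pose proof (Nat.div_mod_eq n 3) as En. pose proof (Nat.mod_upper_bound n 3 ltac:(lia)) as Em.
    set (k := (n / 3)%nat) in *. clearbody k. set (r := (n mod 3)%nat) in *. clearbody r.
    rewrite En, pow_add, pow_mult.
    (* (4/5)^3 = 0.512 exceeds 1/2, and the factor 2 in the bound pays for the at most two further
       shears in the block, as (4/5)^2 = 0.64 does too. *)
    assert (H1 : (/ 2) ^ k <= ((4 / 5) ^ 3) ^ k) by (apply pow_incr; lra).
    pose proof (half_pow_pos k).
    assert (H2 : / 2 <= (4 / 5) ^ r) by (destruct r as [|[|[|r]]]; [| | |lia]; simpl; lra).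
    nra.
  - intros k p Hp.
    assert (Hc : cantor2 (A k) (stage dir f (3 * k) p)).
    { induction k as [|k IH]; [exact Hp|].
      replace (3 * S k)%nat with (S (S (S (3 * k)))) by lia.
      assert (E : forall i, (i < 3)%nat ->
                ((i + 3 * k) / 3 = k)%nat /\ ((i + 3 * k) mod 3 = i)%nat).
      { intros i Hi. replace (i + 3 * k)%nat with (i + k * 3)%nat by lia.
        rewrite Nat.div_add, Nat.Div0.mod_add, Nat.div_small, Nat.mod_small by lia. lia. }
      assert (Ef : forall i, (i < 3)%nat -> f (i + 3 * k)%nat = snd (nxt (k, A k)) i).
      { intros i Hi. unfold f. destruct (E i Hi) as [-> ->]. reflexivity. }
      assert (Ed : forall i, (i < 3)%nat -> dir (i + 3 * k)%nat = Nat.eqb i 1).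
      { intros i Hi. unfold dir. destruct (E i Hi) as [_ ->]. reflexivity. }
      change (stage dir f (S (S (S (3 * k)))) p)
        with (shear (dir (2 + 3 * k)%nat) (f (2 + 3 * k)%nat) 1
               (shear (dir (1 + 3 * k)%nat) (f (1 + 3 * k)%nat) 1
                 (shear (dir (0 + 3 * k)%nat) (f (0 + 3 * k)%nat) 1 (stage dir f (3 * k) p)))).
      rewrite !Ef, !Ed by lia. apply (Hgood k), IH. }
    destruct (Hok k) as [_ Hz]. destruct Hc as [H1 H2].
    split; apply (cantor_small (A k)); assumption.
Qed.

Theorem theorem2p4 :
  forall h : R, 1 < h < 2 ->
  exists (W : R -> pt -> pt) (S : pt -> Prop),
    unif_cont W /\ weakly_div_free W /\
    compact2 S /\ hdim_eq S h /\
    exists X : R -> pt -> pt,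
      trajectory_map W X /\ unique_trajectories W /\
      (forall t, 0 <= t < 1 -> hdim_eq (image (X t) S) h) /\
      (forall y, image (X 1) S y <-> y = (0, 0)).
Proof.
  intros h Hh. destruct (rank_exists (h / 2) ltac:(lra)) as (a & K & Ha & Hd & Hg).
  destruct (shear_sequence (fun l => slot a l = true)) as (dir & f & Hl & Hb & Hst).
  (* Bounded gaps provide a free slot beyond every [n]. *)
  { intros n. destruct (Hg (S n)) as (m & Hm & Hs). exists m. split; [lia|congruence]. }
  assert (Hdim : hdim_eq (cset a) h).
  { replace h with (2 * (h / 2)) by field. apply (cset_dim a (h / 2) K); auto; lra. }
  assert (Hfin : forall z, flow dir f 1 (cpt a z) = (0, 0)).
  { intros z. apply flow_final; [exact Hb|]. intros k. apply Hst. split.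
    - exists (xdig a z). split; [reflexivity|]. intros l H. apply andb_prop in H. tauto.
    - exists (ydig a z). split; [reflexivity|]. intros l H. apply andb_prop in H. tauto. }
  exists (field dir f), (cset a).
  split; [apply field_unif_cont; assumption|]. split; [apply field_div_free; assumption|].
  split; [apply cset_compact, Ha|]. split; [exact Hdim|].
  exists (flow dir f).
  split; [apply flow_trajectory; assumption|]. split; [apply field_unique; assumption|]. split.
  - intros t Ht. apply hdim_bilipschitz; [|exact Hdim]. apply bilipschitz_flow; assumption.
  - intros y. split.
    + intros (p & [z ->] & ->). apply Hfin.
    + intros ->. exists (cpt a (fun _ => false)). split; [eexists; reflexivity|].
      symmetry. apply Hfin.
Qed.
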